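(* Let $n\in\mathbb{N}$ with $n\geq 2$ and let $d_1,\ldots,d_n\in\mathbb{N}$ be such that $d_i$ does not divide $d_j$ whenever $i\neq j$, and $\gcd(d_1,\ldots,d_n)=1$. Let $(p_1,q_1),\ldots,(p_n,q_n)\in\mathbb{Z}_+^2$ be distinct pairs such that $d_j=|q_j-p_j|$ for $1\leq j\leq n$. Suppose that $X$ is a compact subset of $\mathbb{C}$ such that for some $\beta_1,\ldots,\beta_n\in(0,1)$ with $\beta_1+\cdots+\beta_n=1$, $$1\in X\quad\text{and}\quad\bigcup_{j=1}^n r_j\mathfrak{G}_{d_j}\subseteq X\quad\text{with } r_j=\beta_j^{-\frac{1}{p_j+q_j}},$$ where $\mathfrak{G}_k=\{z\in\mathbb{C}\colon z^k=1\}$ for $k\in\mathbb{N}$. Let $\xi\in C(X)$ be given by $\xi(z)=z$ for $z\in X$, and let $\mathcal{M}$ be the linear span of $\{1\}\cup\{\bar\xi^{p_j}\xi^{q_j}\colon 1\leq j\leq n\}$ in $C(X)$. Then $C^*(\mathcal{M})=C(X)$ and $1\in X\setminus\partial_{\mathcal{M}}X$, where $\partial_{\mathcal{M}}X$ is the Choquet boundary for $\mathcal{M}$. In particular, the set $G:=\{\bar\xi^{p_j}\xi^{q_j}\colon 1\leq j\leq n\}$ is not hyperrigid in $C(X)$.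
   Context: $\mathbb{N}$ is the set of positive integers, $\mathbb{Z}_+$ the set of nonnegative integers. $C(X)$ is the $C^*$-algebra of continuous complex functions on $X$ with the supremum norm; for nonempty $G\subseteq C(X)$, $C^*(G)$ is the smallest $C^*$-subalgebra of $C(X)$ containing $G\cup\{1\}$. Choquet boundary: for a subspace $\mathcal{M}\subseteq C(X)$ with $1\in\mathcal{M}$, the state space $S(\mathcal{M})$ is the set of continuous linear functionals $L$ on $\mathcal{M}$ with $L(1)=1=\|L\|$; $\partial_{\mathcal{M}}X$ is the set of all $\lambda\in X$ such that the evaluation functional $\delta_\lambda\colon\mathcal{M}\ni f\mapsto f(\lambda)$ is an extreme point of $S(\mathcal{M})$. Hyperrigidity: a nonempty subset $G$ of a unital $C^*$-algebra $\mathscr{A}$ is hyperrigid (in $\mathscr{A}$) if for any faithful representation (unital $*$-homomorphism) $\pi\colon\mathscr{A}\to\boldsymbol{B}(\mathcal{H})$ on a complex Hilbert space $\mathcal{H}$ and any sequence $\Phi_k\colon\boldsymbol{B}(\mathcal{H})\to\boldsymbol{B}(\mathcal{H})$ ($k\in\mathbb{N}$) of unital completely positive linear maps, if $\lim_{k\to\infty}\|\Phi_k(\pi(g))-\pi(g)\|=0$ for all $g\in G$, then $\lim_{k\to\infty}\|\Phi_k(\pi(a))-\pi(a)\|=0$ for all $a\in\mathscr{A}$. *)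

(* Defs.v *)
From HB Require Import structures.
From mathcomp Require Import all_boot all_order all_algebra.
From mathcomp Require Import all_classical all_reals all_analysis.
From mathcomp Require Import complex.

Set Implicit Arguments.
Unset Strict Implicit.
Unset Printing Implicit Defensive.

Import Order.TTheory GRing.Theory Num.Theory.
Import numFieldNormedType.Exports.
Local Open Scope classical_set_scope.
Local Open Scope ring_scope.

(* MathComp-Analysis does not find the topology and the norm of R[i] from its
   head symbol. *)
HB.instance Definition _ (R : realType) :=
  NormedModule.copy R[i] (R[i] : numClosedFieldType).

(* Norms over R[i] are R[i]-valued; rnorm is the same number seen in R, where
   suprema are available. *)
Definition rnorm (R : realType) (V : normedZmodType R[i]) (v : V) : R :=
  complex.Re `|v|.

Section ContinuousFunctions.
Context (R : realType) (K : topologicalType).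

Definition cfun : Type := continuousType K R[i].

HB.instance Definition _ := Choice.on cfun.

Definition is_cfun : {pred K -> R[i]} := fun f => `[< continuous f >].

Fact cfun_subP (f : cfun) : (f : K -> R[i]) \in is_cfun.
Proof. by apply/asboolP; exact: cts_fun. Qed.

Definition cfun_sub (f : K -> R[i]) (fc : f \in is_cfun) : cfun :=
  mkcts (asboolW fc).

Fact cfun_sub_rect (P : cfun -> Type) :
  (forall f fc, P (@cfun_sub f fc)) -> forall f, P f.
Proof.
move=> Pf f; rewrite (_ : f = cfun_sub (cfun_subP f)) //.
by apply/continuousEP.
Qed.

HB.instance Definition _ :=
  @isSub.Build (K -> R[i]) is_cfun cfun (fun f => f) cfun_sub cfun_sub_rect
    (fun f fc => erefl).

Fact is_cfun_subring : subring_closed is_cfun.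
Proof.
split=> [|f g /asboolP fc /asboolP gc|f g /asboolP fc /asboolP gc];
    apply/asboolP => x.
- exact: cvg_cst.
- exact: cvgB (fc x) (gc x).
- exact: cvgM (fc x) (gc x).
Qed.

Fact is_cfun_submod : subsemimod_closed is_cfun.
Proof.
split=> [|a f /asboolP fc].
- by split=> [|f g /asboolP fc /asboolP gc]; apply/asboolP => x;
    [exact: cvg_cst | exact: cvgD (fc x) (gc x)].
- by apply/asboolP => x; apply: cvgM (fc x); exact: cvg_cst.
Qed.

HB.instance Definition _ :=
  GRing.SubChoice_isSubPzRing.Build (K -> R[i]) is_cfun cfun is_cfun_subring.
HB.instance Definition _ :=
  GRing.SubZmodule_isSubLmodule.Build R[i] (K -> R[i]) is_cfun cfun
    is_cfun_submod.

Fact cfun_conj_continuous (f : cfun) : continuous (fun x => (f x)^* : R[i]).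
Proof.
move=> x; apply/cvgrPdist_lt => e e0.
have /cvgrPdist_lt/(_ e e0) := @cts_fun _ _ f x.
by apply: filterS => y; rewrite -rmorphB norm_conjC.
Qed.

Definition cfun_conj (f : cfun) : cfun := mkcts (@cfun_conj_continuous f).

(* The norm of C(K); junk unless f is bounded, as it is for K compact. *)
Definition supnorm (f : cfun) : R := sup (range (fun x => rnorm (f x))).

End ContinuousFunctions.

Section CstarSubalgebras.
Context (R : realType) (K : topologicalType).

Definition cstar_subalgebra (B : set (cfun R K)) : Prop :=
  [/\ B 0,
      forall (a : R[i]) f g, B f -> B g -> B (a *: f + g),
      forall f g, B f -> B g -> B (f * g),
      forall f, B f -> B (cfun_conj f)
    & forall f, (forall e : R, 0 < e -> exists2 g, B g & supnorm (f - g) < e) ->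
        B f].

Definition Cstar (G : set (cfun R K)) : set (cfun R K) :=
  smallest cstar_subalgebra (G `|` [set 1]).

End CstarSubalgebras.

Section ChoquetBoundary.
Context (R : realType).

Definition lspan (V : lmodType R[i]) (G : set V) : set V :=
  [set v | exists m (a : 'I_m -> R[i]) (g : 'I_m -> V),
     (forall i, G (g i)) /\ v = \sum_i a i *: g i].

Definition extreme_point (V : lmodType R[i]) (S : set V) (v : V) : Prop :=
  S v /\ forall (u w : V) (t : R), S u -> S w -> 0 < t < 1 ->
    v = (t%:C)%C *: u + ((1 - t)%:C)%C *: w -> u = v /\ w = v.

Context (K : topologicalType) (M : set (cfun R K)).

(* M is meant to be a subspace of C(K); its elements form the type M, and
   linearity is stated without giving that type a module structure. *)
Definition linear_functional (L : M -> R[i]) : Prop :=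
  forall (a : R[i]) (f g h : M),
    \val h = a *: \val f + \val g -> L h = a * L f + L g.

Definition continuous_functional (L : M -> R[i]) : Prop :=
  forall (f : M) (e : R), 0 < e -> exists2 d : R, 0 < d &
    forall g : M, supnorm (\val g - \val f) < d -> rnorm (L g - L f) < e.

Definition functional_norm (L : M -> R[i]) : R :=
  sup [set rnorm (L f) | f in [set f : M | supnorm (\val f) <= 1]].

Definition state_space : set (M -> R[i]) :=
  [set L | [/\ linear_functional L, continuous_functional L,
     forall f : M, \val f = 1 -> L f = 1 & functional_norm L = 1]].

Definition choquet_boundary : set K :=
  [set x | extreme_point state_space (fun f : M => (\val f : cfun R K) x)].

End ChoquetBoundary.

Record hilbertType (R : realType) := HilbertType {
  hilbert_sort :> completeNormedModType R[i];
  hdot : {dot hilbert_sort for Num.conj};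
  hdotE : forall x : hilbert_sort, `|x| ^+ 2 = hdot x x }.

Section BoundedOperators.
Context (R : realType) (H : hilbertType R).

Definition is_bop : {pred H -> H} := fun T => `[< linear T /\ continuous T >].

Record bop := Bop { bop_fun :> H -> H; _ : bop_fun \in is_bop }.

HB.instance Definition _ := [isSub for bop_fun].
HB.instance Definition _ := [Choice of bop by <:].

Fact is_bop_submod : subsemimod_closed is_bop.
Proof.
split.
  split=> [|S T /asboolP[Sl Sc] /asboolP[Tl Tc]]; apply/asboolP; split.
  - by move=> a x y; rewrite /= scaler0 addr0.
  - by move=> x; exact: cvg_cst.
  - move=> a x y; rewrite /= [LHS](_ : _ = S (a *: x + y) + T (a *: x + y)) //.
    by rewrite Sl Tl scalerDr addrACA.
  - by move=> x; exact: cvgD (Sc x) (Tc x).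
move=> b T /asboolP[Tl Tc]; apply/asboolP; split.
- move=> a x y; rewrite [LHS](_ : _ = b *: T (a *: x + y)) //.
  by rewrite Tl scalerDr !scalerA mulrC.
- by move=> x; exact: cvgZ (cvg_cst b) (Tc x).
Qed.

HB.instance Definition _ :=
  GRing.SubChoice_isSubZmodule.Build (H -> H) is_bop bop
    (GRing.subsemimod_closedB is_bop_submod).
HB.instance Definition _ :=
  GRing.SubZmodule_isSubLmodule.Build R[i] (H -> H) is_bop bop is_bop_submod.

Fact bop1_subproof : idfun \in is_bop.
Proof. by apply/asboolP; split=> // x; exact: cvg_id. Qed.

Definition bop1 : bop := Bop bop1_subproof.

Fact bopM_subproof (S T : bop) : S \o T \in is_bop.
Proof.
case: S T => [S /asboolP[Sl Sc]] [T /asboolP[Tl Tc]] /=; apply/asboolP; split.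
- by move=> a x y /=; rewrite Tl Sl.
- by move=> x; apply: continuous_comp; [exact: Tc | exact: Sc].
Qed.

Definition bopM (S T : bop) : bop := Bop (bopM_subproof S T).

Definition opnorm (T : bop) : R :=
  sup [set rnorm (T x) | x in [set x : H | rnorm x <= 1]].

Definition is_adjoint (S T : bop) : Prop :=
  forall x y : H, hdot H (S x) y = hdot H x (T y).

(* [T i j] acts as a block operator on H^m; 0 <= z in R[i] forces z real. *)
Definition positive_block m (T : 'M[bop]_m) : Prop :=
  forall x : 'I_m -> H, 0 <= \sum_i \sum_j hdot H (T i j (x j)) (x i).

Definition completely_positive (Phi : bop -> bop) : Prop :=
  forall m (T : 'M[bop]_m), positive_block T -> positive_block (map_mx Phi T).

Definition ucp (Phi : bop -> bop) : Prop :=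
  [/\ linear Phi, Phi bop1 = bop1 & completely_positive Phi].

Context (K : topologicalType).

Definition representation (pi : cfun R K -> bop) : Prop :=
  [/\ linear pi, pi 1 = bop1, forall f g, pi (f * g) = bopM (pi f) (pi g)
    & forall f, is_adjoint (pi (cfun_conj f)) (pi f)].

End BoundedOperators.

(* Hyperrigidity in the C*-algebra C(K), for K compact. *)
Definition hyperrigid (R : realType) (K : topologicalType)
    (G : set (cfun R K)) : Prop :=
  forall (H : hilbertType R) (pi : cfun R K -> bop H),
    representation pi -> injective pi ->
  forall Phi : nat -> bop H -> bop H, (forall k, ucp (Phi k)) ->
    (forall g, G g ->
       opnorm (Phi k (pi g) - pi g) @[k --> \oo] --> (0 : R)) ->
    forall f, opnorm (Phi k (pi f) - pi f) @[k --> \oo] --> (0 : R).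

Definition roots_of_unity (R : realType) (k : nat) : set R[i] :=
  [set z | z ^+ k = 1].

Section Coordinate.
Context (R : realType) (X : set R[i]).

Fact xi_continuous : continuous (set_val : X -> R[i]).
Proof. exact: initial_continuous. Qed.

Definition xi : cfun R X := mkcts xi_continuous.

Definition monomials n (p q : 'I_n -> nat) : set (cfun R X) :=
  [set cfun_conj xi ^+ p j * xi ^+ q j | j in [set: 'I_n]].

End Coordinate.
Arguments xi {R} X.
Arguments monomials {R} X {n}.

(* Main.v *)
(* For a primitive [d_j]-th root of unity [z_j], the mean over [k] of
   conj(w)^p_i w^q_i at w = r_j z_j^k vanishes unless d_j divides d_i, that is
   unless i = j, where it is r_j^(p_j + q_j) = 1 / beta_j.  Hence the evaluation
   at 1 agrees on M with the average, of weights beta_j / d_j, of the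
   evaluations at the points r_j z_j^k, and it is not extreme: these points
   carry values 1 / beta_j <> 1 of the generators.  The same average breaks
   hyperrigidity on the Hilbert space l2(X), where C(X) acts by multiplication:
   replacing the entry of an operator at (1, 1) by the average of its entries at
   (x, x), x = r_j z_j^k, and killing the rest of that row and column, is a
   unital completely positive map which fixes the generators but not all of
   C(X).  Finally the generators separate the points of X because the gcd of
   the d_j is 1, so that Stone-Weierstrass yields C*(M) = C(X). *)

Require Import Defs.
From HB Require Import structures.
From mathcomp Require Import all_boot all_order all_algebra.
From mathcomp Require Import all_classical all_reals all_analysis.
From mathcomp Require Import cyclic separable cyclotomic.
From mathcomp Require Import complex finmap summability ring lra.

Set Implicit Arguments.
Unset Strict Implicit.
Unset Printing Implicit Defensive.

Import Order.TTheory GRing.Theory Num.Theory.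
Import numFieldNormedType.Exports.
Local Open Scope classical_set_scope.
Local Open Scope ring_scope.

(** * Real-valued norms and limits in [R[i]] *)

Section RealNorm.
Context (R : realType).
Implicit Types V : normedZmodType R[i].

Lemma rnormE V (v : V) : `|v| = (rnorm v)%:C%C.
Proof.
have := ger0_Im (normr_ge0 v); rewrite /rnorm.
by case: (`|v|) => a b /= ->.
Qed.

Lemma rnorm_ge0 V (v : V) : 0 <= rnorm v.
Proof. by rewrite -ler0c -rnormE. Qed.

Lemma rnorm0 V : rnorm (0 : V) = 0.
Proof. by rewrite /rnorm normr0. Qed.

Lemma rnorm_eq0 V (v : V) : rnorm v = 0 -> v = 0.
Proof. by move=> v0; apply/eqP; rewrite -normr_eq0 rnormE v0. Qed.

Lemma rnormN V (v : V) : rnorm (- v) = rnorm v.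
Proof. by rewrite /rnorm normrN. Qed.

Lemma rnormB V (u v : V) : rnorm (u - v) = rnorm (v - u).
Proof. by rewrite -rnormN opprB. Qed.

Lemma ler_rnormD V (u v : V) : rnorm (u + v) <= rnorm u + rnorm v.
Proof. by rewrite -lecR rmorphD/= -!rnormE; exact: ler_normD. Qed.

Lemma rnormM (a b : R[i]) : rnorm (a * b) = rnorm a * rnorm b.
Proof. by apply: complexI; rewrite rmorphM/= -!rnormE normrM. Qed.

Lemma rnormZ (V : normedModType R[i]) (a : R[i]) (v : V) :
  rnorm (a *: v) = rnorm a * rnorm v.
Proof. by apply: complexI; rewrite rmorphM/= -!rnormE normrZ. Qed.

Lemma rnorm_real (a : R) : rnorm (a%:C%C : R[i]) = `|a|.
Proof. by rewrite /rnorm normc_def/= expr0n addr0 sqrtr_sqr. Qed.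

Lemma rnorm1 : rnorm (1 : R[i]) = 1.
Proof. by rewrite /rnorm normr1. Qed.

Lemma rnormV (a : R[i]) : rnorm a^-1 = (rnorm a)^-1.
Proof. by apply: complexI; rewrite fmorphV/= -!rnormE normfV. Qed.

Lemma ReB (a b : R[i]) : complex.Re (a - b) = complex.Re a - complex.Re b.
Proof. by case: a b => [? ?] []. Qed.

Lemma ImB (a b : R[i]) : complex.Im (a - b) = complex.Im a - complex.Im b.
Proof. by case: a b => [? ?] []. Qed.

Lemma rnorm_conj (a : R[i]) : rnorm (a^*) = rnorm a.
Proof. by rewrite /rnorm norm_conjC. Qed.

Lemma sqr_rnorm (a : R[i]) :
  rnorm a ^+ 2 = complex.Re a ^+ 2 + complex.Im a ^+ 2.
Proof.
by rewrite /rnorm normc_def /= sqr_sqrtr// addr_ge0// sqr_ge0.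
Qed.

Lemma ler_Re_rnorm (a : R[i]) : `|complex.Re a| <= rnorm a.
Proof.
by rewrite -[leRHS]ger0_norm ?rnorm_ge0// -ler_sqr ?nnegrE// !real_normK
  ?num_real// sqr_rnorm lerDl sqr_ge0.
Qed.

Lemma ler_Im_rnorm (a : R[i]) : `|complex.Im a| <= rnorm a.
Proof.
by rewrite -[leRHS]ger0_norm ?rnorm_ge0// -ler_sqr ?nnegrE// !real_normK
  ?num_real// sqr_rnorm lerDr sqr_ge0.
Qed.

(** A positive element of [R[i]] has zero imaginary part, so the radii of the [R[i]]-valued
    criterion are exactly the real ones. *)
Lemma cvg_rnormP (V : normedModType R[i]) (T : Type) (F : set_system T)
    (FF : Filter F) (f : T -> V) (l : V) :
  f @ F --> l <-> forall e : R, 0 < e -> \forall x \near F, rnorm (l - f x) < e.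
Proof.
split=> [/cvgrPdist_lt fl e e0|fl].
  have := fl e%:C%C; rewrite ltcR => /(_ e0); apply: filterS => x.
  by rewrite rnormE ltcR.
apply/cvgrPdist_lt => e; rewrite ltcE => /andP[/= /eqP ie re].
apply: filterS (fl _ re) => x lx.
by rewrite rnormE ltcE/= ie eqxx.
Qed.

Lemma cvg_realC (T : Type) (F : set_system T) (FF : Filter F) (f : T -> R)
    (l : R) :
  f @ F --> l -> (fun x => (f x)%:C%C : R[i]) @ F --> (l%:C%C : R[i]).
Proof.
move=> /cvgrPdist_lt fl; apply/cvg_rnormP => e e0.
by apply: filterS (fl _ e0) => x; rewrite -rmorphB/= rnorm_real.
Qed.

Lemma cvg_rnorm (V : normedModType R[i]) (T : Type) (F : set_system T)
    (FF : Filter F) (f : T -> V) (l : V) :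
  f @ F --> l -> (fun x => rnorm (f x)) @ F --> rnorm l.
Proof.
move=> /cvg_rnormP fl; apply/cvgrPdist_lt => e e0.
apply: filterS (fl _ e0) => x; apply: le_lt_trans.
rewrite ler_norml lerNl opprB !lerBlDr; apply/andP; split.
  by rewrite rnormB -{1}(subrK l (f x)) ler_rnormD.
by rewrite -{1}(subrK (f x) l) ler_rnormD.
Qed.

Lemma cvg_conj (T : Type) (F : set_system T) (FF : Filter F) (f : T -> R[i])
    (l : R[i]) : f @ F --> l -> (fun x => (f x)^*) @ F --> l^*.
Proof.
move=> /cvg_rnormP fl; apply/cvg_rnormP => e e0.
by apply: filterS (fl _ e0) => x; rewrite -rmorphB/= rnorm_conj.
Qed.

Lemma cvg_complexRe (T : Type) (F : set_system T) (FF : Filter F)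
    (f : T -> R[i]) (l : R[i]) :
  f @ F --> l -> (fun x => complex.Re (f x)) @ F --> complex.Re l.
Proof.
move=> /cvg_rnormP fl; apply/cvgrPdist_lt => e e0.
apply: filterS (fl _ e0) => x; apply: le_lt_trans.
by rewrite -ReB ler_Re_rnorm.
Qed.

Lemma cvg_complexIm (T : Type) (F : set_system T) (FF : Filter F)
    (f : T -> R[i]) (l : R[i]) :
  f @ F --> l -> (fun x => complex.Im (f x)) @ F --> complex.Im l.
Proof.
move=> /cvg_rnormP fl; apply/cvgrPdist_lt => e e0.
apply: filterS (fl _ e0) => x; apply: le_lt_trans.
by rewrite -ImB ler_Im_rnorm.
Qed.

Lemma cvg_complexP (T : Type) (F : set_system T) (FF : Filter F)
    (f : T -> R[i]) :
  cvg ((fun x => complex.Re (f x)) @ F) ->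
  cvg ((fun x => complex.Im (f x)) @ F) ->
  cvg (f @ F).
Proof.
move=> /cvg_ex[a fa] /cvg_ex[b fb]; apply/cvg_ex.
exists (a%:C%C + 'i%C * b%:C%C)%R.
rewrite [f](_ : _ =
  fun x => (complex.Re (f x))%:C%C + 'i%C * (complex.Im (f x))%:C%C).
  by apply: cvgD; [|apply: cvgMl_tmp]; exact: cvg_realC.
by apply/funext => x; rewrite -complexE.
Qed.

End RealNorm.

(** * Square-summable families *)

Section SquareSummable.
Context (R : realType) (T : choiceType).
Implicit Types (f g : T -> R[i]) (A B : {fset T}).

Definition psum f A : R := \sum_(x <- A) rnorm (f x) ^+ 2.

(** The supremum over finite subsets stands for the sum over the possibly uncountable index [T]; it
    is meaningful only for [f \in is_l2]. *)
Definition sqsum f : R := sup (range (psum f)).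

Definition is_l2 : {pred T -> R[i]} :=
  fun f => `[< has_ubound (range (psum f)) >].

Lemma is_l2P f (c : R) : (forall A, psum f A <= c) -> f \in is_l2.
Proof. by move=> fc; apply/asboolP; exists c => _ [A _ <-]. Qed.

Lemma psum_le f A : f \in is_l2 -> psum f A <= sqsum f.
Proof. by move=> /asboolP fl; apply: ub_le_sup => //; exists A. Qed.

Lemma sqsum_le f (c : R) : (forall A, psum f A <= c) -> sqsum f <= c.
Proof.
move=> fc; apply: ge_sup => [|_ [A _ <-]//].
by exists (psum f fset0); exists fset0.
Qed.

Lemma psum_ge0 f A : 0 <= psum f A.
Proof. by apply: sumr_ge0 => x _; rewrite sqr_ge0. Qed.

Lemma sqsum_ge0 f : f \in is_l2 -> 0 <= sqsum f.
Proof. by move=> fl; apply: le_trans (psum_le fset0 fl); exact: psum_ge0. Qed.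

Lemma coord_le_sqsum f x : f \in is_l2 -> rnorm (f x) ^+ 2 <= sqsum f.
Proof. by move=> /(psum_le [fset x]%fset); rewrite /psum big_seq_fset1. Qed.

Lemma psum_mono f A B : (A `<=` B)%fset -> psum f A <= psum f B.
Proof.
move=> AB; rewrite /psum [leRHS](big_fsetID _ (mem A))/=.
rewrite (_ : [fset x in B | x \in A]%fset = A).
  by rewrite lerDl sumr_ge0// => x _; rewrite sqr_ge0.
by apply/fsetP => x; rewrite !inE andb_idl//; exact: (fsubsetP AB).
Qed.

(** With [|a + b| <= |a| + |b|], the gap is the weighted square [t^-1 * (t * |a| - |b|)^2]. The free
    weight [t] is what later yields the sharp triangle inequality without Cauchy-Schwarz. *)
Lemma rnormD_sqr_le (t : R) (a b : R[i]) : 0 < t ->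
  rnorm (a + b) ^+ 2 <= (1 + t) * rnorm a ^+ 2 + (1 + t^-1) * rnorm b ^+ 2.
Proof.
move=> t0; apply: (@le_trans _ _ ((rnorm a + rnorm b) ^+ 2)).
  by rewrite ler_sqr ?nnegrE ?rnorm_ge0 ?addr_ge0 ?rnorm_ge0// ler_rnormD.
rewrite -subr_ge0.
rewrite (_ : _ - _ = t^-1 * (t * rnorm a - rnorm b) ^+ 2); last first.
  by field; rewrite gt_eqF.
by rewrite mulr_ge0 ?invr_ge0 ?sqr_ge0 // ltW.
Qed.

Lemma psumD_le (t : R) f g A : 0 < t ->
  psum (f + g) A <= (1 + t) * psum f A + (1 + t^-1) * psum g A.
Proof.
move=> t0; rewrite /psum !mulr_sumr -big_split/=.
by apply: ler_sum => x _; exact: rnormD_sqr_le.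
Qed.

Lemma psumZ (a : R[i]) f A : psum (a *: f) A = rnorm a ^+ 2 * psum f A.
Proof.
by rewrite /psum mulr_sumr; apply: eq_bigr => x _; rewrite rnormM exprMn.
Qed.

Fact is_l2_submod : subsemimod_closed is_l2.
Proof.
split; first split.
- apply: (@is_l2P _ 0) => A; rewrite /psum big1// => x _.
  by rewrite rnorm0 expr0n.
- move=> f g fl gl; apply: (@is_l2P _ (2 * sqsum f + 2 * sqsum g)) => A.
  apply: le_trans (psumD_le _ _ _ ltr01) _.
  by rewrite invr1 lerD// ler_wpM2l ?psum_le.
move=> a f fl; apply: (@is_l2P _ (rnorm a ^+ 2 * sqsum f)) => A.
by rewrite psumZ ler_wpM2l ?sqr_ge0 ?psum_le.
Qed.

Record l2 := L2 { l2_fun :> T -> R[i]; _ : l2_fun \in is_l2 }.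

HB.instance Definition _ := [isSub for l2_fun].
HB.instance Definition _ := [Choice of l2 by <:].
HB.instance Definition _ :=
  GRing.SubChoice_isSubZmodule.Build (T -> R[i]) is_l2 l2
    (GRing.subsemimod_closedB is_l2_submod).
HB.instance Definition _ :=
  GRing.SubZmodule_isSubLmodule.Build R[i] (T -> R[i]) is_l2 l2 is_l2_submod.

Implicit Types u v w : l2.

Lemma l2E u : (u : T -> R[i]) \in is_l2. Proof. exact: valP. Qed.

Lemma l2_eq u v : (u : T -> R[i]) =1 v -> u = v.
Proof. by move=> uv; apply/val_inj/funext. Qed.

Lemma sqsumD_le (t : R) u v : 0 < t ->
  sqsum (u + v : l2) <= (1 + t) * sqsum u + (1 + t^-1) * sqsum v.
Proof.
move=> t0; apply: sqsum_le => A; apply: le_trans (psumD_le _ _ _ t0) _.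
by rewrite lerD// ler_wpM2l ?psum_le ?l2E// addr_ge0// ?invr_ge0 ltW.
Qed.

Lemma sqsum_eq0 u : sqsum u = 0 -> u = 0.
Proof.
move=> u0; apply: l2_eq => x; apply: rnorm_eq0; apply/eqP.
by rewrite -sqrf_eq0 eq_le sqr_ge0 andbT -u0 coord_le_sqsum ?l2E.
Qed.

Definition l2norm u : R := Num.sqrt (sqsum u).

Lemma l2norm_sqr u : l2norm u ^+ 2 = sqsum u.
Proof. by rewrite sqr_sqrtr// sqsum_ge0 ?l2E. Qed.

Lemma l2norm_eq0 u : l2norm u = 0 -> u = 0.
Proof. by move=> u0; apply: sqsum_eq0; rewrite -l2norm_sqr u0 expr0n. Qed.

(* Optimizing the weight in [sqsumD_le] gives [t = |v| / |u|]. *)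
Lemma l2norm_triangle u v : l2norm (u + v) <= l2norm u + l2norm v.
Proof.
have nu : 0 <= l2norm u := sqrtr_ge0 _.
have nv : 0 <= l2norm v := sqrtr_ge0 _.
have [/l2norm_eq0->|u0] := eqVneq (l2norm u) 0;
  first by rewrite add0r lerDr sqrtr_ge0.
have [/l2norm_eq0->|v0] := eqVneq (l2norm v) 0;
  first by rewrite addr0 lerDl sqrtr_ge0.
have t0 : 0 < l2norm v / l2norm u by rewrite divr_gt0 ?lt0r ?u0 ?v0.
rewrite -ler_sqr ?nnegrE ?addr_ge0 ?sqrtr_ge0// l2norm_sqr.
apply: le_trans (sqsumD_le u v t0) _; rewrite -!l2norm_sqr.
by rewrite le_eqVlt; apply/orP; left; apply/eqP; field; rewrite ?u0 ?v0.
Qed.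

(** The inequality [h] holds for every scalar; the reverse one is [h] for [a^-1] and [a *: u]. *)
Lemma sqsumZ (a : R[i]) u : sqsum (a *: u : l2) = rnorm a ^+ 2 * sqsum u.
Proof.
have h (b : R[i]) v : sqsum (b *: v : l2) <= rnorm b ^+ 2 * sqsum v.
  apply: sqsum_le => A.
  by rewrite psumZ ler_wpM2l ?sqr_ge0 ?psum_le ?l2E.
apply/eqP; rewrite eq_le h/=; have [->|a0] := eqVneq a 0.
  by rewrite rnorm0 expr0n/= mul0r; exact: (sqsum_ge0 (l2E (0 *: u))).
have := h a^-1 (a *: u); rewrite scalerA mulVf// scale1r => hu.
have na : 0 < rnorm a.
  by rewrite lt0r rnorm_ge0 andbT; apply: contra_neq a0 => /rnorm_eq0.
rewrite -(ler_pdivlMl _ _ (exprn_gt0 2 na)); apply: le_trans hu _.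
by rewrite rnormV exprVn.
Qed.

Lemma l2normZ (a : R[i]) u : l2norm (a *: u) = rnorm a * l2norm u.
Proof.
by rewrite /l2norm sqsumZ sqrtrM ?sqr_ge0// sqrtr_sqr ger0_norm ?rnorm_ge0.
Qed.

(** Partial sums grow with the finite set, so along [totally] they converge to their supremum. *)
Lemma cvg_psum f : f \in is_l2 -> psum f @ totally --> sqsum f.
Proof.
move=> fl; have FF := @totally_filter T; apply/cvgrPdist_lt => e e0.
have [|A Ae] := @sup_adherent _ (range (psum f)) e e0.
  by split; [exists (psum f fset0); exists fset0|apply/asboolP].
move: Ae => [A' _ <-] Ae.
exists A' => // B /= AB; rewrite ger0_norm ?subr_ge0 ?psum_le//.
rewrite ltrBlDr -ltrBlDl; apply: lt_le_trans Ae _; exact: psum_mono.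
Qed.

#[local] Existing Instance totally_filter.

(** Polarization expresses the inner product through sums of squares, which are already available as
    suprema; summability of the products [u x * (v x)^*] then comes for free in [cvg_l2dot]. *)
Definition l2dot u v : R[i] :=
  4^-1 * ((sqsum (u + v : l2))%:C - (sqsum (u - v : l2))%:C
    + 'i * ((sqsum (u + 'i *: v : l2))%:C - (sqsum (u - 'i *: v : l2))%:C))%C.

Lemma polarization (a b : R[i]) :
  a * b^* = 4^-1 * ((rnorm (a + b) ^+ 2)%:C - (rnorm (a - b) ^+ 2)%:C
    + 'i * ((rnorm (a + 'i * b) ^+ 2)%:C - (rnorm (a - 'i * b) ^+ 2)%:C))%C.
Proof.
rewrite (_ : 4^-1 = (4^-1)%:C%C); last by rewrite fmorphV rmorph_nat.
rewrite !sqr_rnorm; case: a b => [a1 a2] [b1 b2].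
by apply/eqP; rewrite eq_complex/=; apply/andP; split; apply/eqP => /=; field.
Qed.

Lemma cvg_l2dot u v :
  (fun A => \sum_(x <- A) u x * (v x)^*) @ totally --> l2dot u v.
Proof.
rewrite [X in X @ _](_ : _ = fun A =>
  4^-1 * ((psum (u + v : l2) A)%:C - (psum (u - v : l2) A)%:C
    + 'i * ((psum (u + 'i *: v : l2) A)%:C - (psum (u - 'i *: v : l2) A)%:C))%C).
  have h (w : l2) :
    (fun A => (psum w A)%:C%C) @ totally --> ((sqsum w)%:C%C : R[i]).
    by apply: cvg_realC; exact: cvg_psum (l2E w).
  apply: cvgMl_tmp; apply: cvgD; first exact: cvgB (h (u + v)) (h (u - v)).
  by apply: cvgMl_tmp; exact: cvgB (h (u + 'i%C *: v)) (h (u - 'i%C *: v)).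
apply/funext => A; rewrite /psum !rmorph_sum/= -!sumrB mulr_sumr -big_split/=.
by rewrite mulr_sumr; apply: eq_bigr => x _; rewrite polarization.
Qed.

(** By uniqueness of limits, identities between inner products reduce to identities between finite
    sums, which is how sesquilinearity and symmetry are obtained below. *)
Lemma l2dot_eq u v (l : R[i]) :
  (fun A => \sum_(x <- A) u x * (v x)^*) @ totally --> l -> l2dot u v = l.
Proof.
by move=> h; exact: (cvg_unique (@norm_hausdorff _ R[i]) (@cvg_l2dot u v) h).
Qed.

Lemma l2dot_ext u v u' v' :
  (forall x, u x * (v x)^* = u' x * (v' x)^*) -> l2dot u v = l2dot u' v'.
Proof.
move=> uv; apply: l2dot_eq; rewrite [X in X @ _](_ : _ =
  fun A => \sum_(x <- A) u' x * (v' x)^*); first exact: cvg_l2dot.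
by apply/funext => A; apply: eq_bigr => x _.
Qed.

Lemma l2dotC u v : l2dot u v = (l2dot v u)^*.
Proof.
apply: l2dot_eq; rewrite [X in X @ _](_ : _ =
  fun A => (\sum_(x <- A) v x * (u x)^*)^*).
  by apply: cvg_conj; exact: cvg_l2dot.
apply/funext => A; rewrite rmorph_sum; apply: eq_bigr => x _.
by rewrite rmorphM/= conjCK mulrC.
Qed.

Lemma l2dot_linearl w : GRing.linear_for *%R (l2dot^~ w).
Proof.
move=> a u v; apply: l2dot_eq; rewrite [X in X @ _](_ : _ = fun A =>
  a * (\sum_(x <- A) u x * (w x)^*) + \sum_(x <- A) v x * (w x)^*).
  apply: cvgD; last exact: cvg_l2dot.
  by apply: cvgMl_tmp; exact: cvg_l2dot.
apply/funext => A; rewrite mulr_sumr -big_split/=.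
by apply: eq_bigr => x _; rewrite mulrA -mulrDl.
Qed.

Lemma l2dot_bilinear :
  bilinear_for *%R (Num.conj \; *%R) l2dot.
Proof.
split=> w a u v; first exact: l2dot_linearl.
rewrite l2dotC l2dot_linearl rmorphD rmorphM/=.
by rewrite -(l2dotC w u) -(l2dotC w v).
Qed.

Lemma l2dot_sqsum u : l2dot u u = (sqsum u)%:C%C.
Proof.
apply: l2dot_eq; rewrite [X in X @ _](_ : _ = fun A => (psum u A)%:C%C).
  by apply: cvg_realC; exact: cvg_psum (l2E u).
apply/funext => A; rewrite rmorph_sum/=; apply: eq_bigr => x _.
by rewrite -normCK rnormE rmorphXn.
Qed.

Lemma l2dot_gt0 u : u != 0 -> 0 < l2dot u u.
Proof.
move=> u0; rewrite l2dot_sqsum ltcR lt0r sqsum_ge0 ?l2E// andbT.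
by apply: contra_neq u0; exact: sqsum_eq0.
Qed.

HB.instance Definition _ := bilinear_isBilinear.Build R[i] l2 l2 R[i]
  *%R (Num.conj \; *%R) l2dot l2dot_bilinear.

HB.instance Definition _ := isHermitianSesquilinear.Build R[i] l2 false
  Num.conj l2dot (fun u v => etrans (l2dotC u v) (esym (mul1r _))).

HB.instance Definition _ := isDotProduct.Build R[i] l2 l2dot l2dot_gt0.

Fact l2_normD u v :
  (l2norm (u + v))%:C%C <= (l2norm u)%:C%C + (l2norm v)%:C%C :> R[i].
Proof. by rewrite -rmorphD lecR; exact: l2norm_triangle. Qed.

Fact l2_normZ (a : R[i]) u : (l2norm (a *: u))%:C%C = `|a| * (l2norm u)%:C%C.
Proof. by rewrite l2normZ rmorphM rnormE. Qed.

Fact l2_norm_eq0 u : (l2norm u)%:C%C = 0 :> R[i] -> u = 0.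
Proof. by move=> /complexI/l2norm_eq0. Qed.

HB.instance Definition _ := Lmodule_isNormed.Build R[i] l2
  l2_normD l2_normZ l2_norm_eq0.

Lemma rnorm_l2 u : rnorm u = l2norm u. Proof. by []. Qed.

Lemma coord_le_rnorm u x : rnorm (u x) <= rnorm u.
Proof.
by rewrite -ler_sqr ?nnegrE ?rnorm_ge0// l2norm_sqr coord_le_sqsum ?l2E.
Qed.

Lemma l2_cauchy_near (F : set_system l2) (FF : Filter F) : cauchy F ->
  forall e : R, 0 < e -> \forall u & v \near F, rnorm (u - v) < e.
Proof.
move=> /cauchy_ballP cF e e0; have := cF e%:C%C; rewrite ltcR => /(_ e0).
by apply: filterS => -[u v]; rewrite -ball_normE/= /ball_/= rnormE ltcR.
Qed.

(** Coordinates, real parts and imaginary parts are all 1-Lipschitz, so the claim follows from the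
    completeness of [R]. *)
Lemma l2_cauchy_coord (F : set_system l2) (FF : ProperFilter F) (x : T) :
  cauchy F -> cvg ((fun u : l2 => u x) @ F).
Proof.
move=> /l2_cauchy_near cF.
have h (p : R[i] -> R) : (forall a b, `|p a - p b| <= rnorm (a - b)) ->
    cvg ((fun u : l2 => p (u x)) @ F).
  move=> pl; apply/cauchy_cvgP/cauchy_ballP => e e0.
  rewrite near_map2; apply: filterS (cF _ e0) => -[u v] /= uv.
  rewrite -ball_normE/=; apply: le_lt_trans (pl _ _) _.
  exact: le_lt_trans (coord_le_rnorm (u - v) x) uv.
apply: cvg_complexP; apply: h => a b.
  by rewrite -ReB ler_Re_rnorm.
by rewrite -ImB ler_Im_rnorm.
Qed.

(** The limit is the coordinatewise limit [h]. For [u] far along the filter, the partial sums of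
    [u - v] over a finite set are small for [v] near the limit; letting [v] tend to [h] bounds those
    of [u - h] uniformly in the finite set. This gives both [h = u - (u - h) \in is_l2] and
    convergence in norm. *)
Fact l2_complete (F : set_system l2) : ProperFilter F -> cauchy F -> cvg F.
Proof.
move=> FF cF; pose h x := lim ((fun u : l2 => u x) @ F).
have Fh x : (fun u : l2 => u x) @ F --> h x by exact: l2_cauchy_coord.
have key (e : R) : 0 < e ->
    \forall u \near F, forall A, psum (l2_fun u - h) A <= e ^+ 2.
  move=> e0; have /nearP_dep := l2_cauchy_near FF cF e0.
  apply: filterS => u uF A.
  apply: (@cvgr_to_le _ F FF R (fun v : l2 => psum (u - v : l2) A)).
    apply: cvg_big => [|x _]; first exact: add_continuous.
    rewrite expr2; apply: cvgM.
      by apply: cvg_rnorm; apply: cvgB; [exact: cvg_cst|exact: Fh].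
    by apply: cvg_rnorm; apply: cvgB; [exact: cvg_cst|exact: Fh].
  apply: filterS uF => v uv; apply: le_trans (psum_le A (l2E _)) _.
  by rewrite -l2norm_sqr ler_sqr ?nnegrE ?sqrtr_ge0 ?ltW.
have hl : h \in is_l2.
  have /filter_ex[u uh] := key 1 ltr01.
  rewrite (_ : h = l2_fun u - (l2_fun u - h)); last first.
    by rewrite opprB addrC subrK.
  apply: (GRing.subsemimod_closedB is_l2_submod).2; first exact: l2E.
  exact: is_l2P uh.
apply/cvg_ex; exists (L2 hl); apply/cvg_rnormP => e e0.
(* Suprema only preserve non-strict bounds; halving [e] restores the strict one. *)
have e20 : 0 < e / 2 by rewrite divr_gt0.
apply: filterS (key _ e20) => u uh; rewrite rnormB rnorm_l2.
apply: (@le_lt_trans _ _ (e / 2)); last first.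
  by rewrite ltr_pdivrMr// ltr_pMr// ltr1n.
rewrite -ler_sqr ?nnegrE ?sqrtr_ge0// ?(ltW e20)// l2norm_sqr.
exact: sqsum_le.
Qed.

HB.instance Definition _ := Uniform_isComplete.Build l2 l2_complete.

End SquareSummable.

(** * Bounded operators *)

Section BoundedOperatorConstructions.
Context (R : realType).

Lemma bounded_is_bop (H : hilbertType R) (S : H -> H) (c : R) :
  linear S -> (forall v, rnorm (S v) <= c * rnorm v) -> S \in @is_bop R H.
Proof.
move=> Sl Sc; apply/asboolP; split=> // u.
pose S' : {linear H -> H} := HB.pack S (GRing.isLinear.Build _ _ _ _ S Sl).
(* The constant [c] may be zero or negative, so [|c| + 1] is the Lipschitz constant to divide by. *)
have c0 : 0 < `|c| + 1 by rewrite ltr_wpDl.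
apply/cvg_rnormP => e e0.
have /cvg_rnormP/(_ (e / (`|c| + 1))) : u @[u --> u] --> u by exact: cvg_id.
rewrite divr_gt0// => /(_ erefl); apply: filterS => v uv.
rewrite -(raddfB S')/=; apply: le_lt_trans (Sc _) _.
move: uv; rewrite ltr_pdivlMr// mulrC; apply: le_lt_trans.
by rewrite ler_wpM2r ?rnorm_ge0// (le_trans (ler_norm c))// lerDl.
Qed.

Lemma bop_eq (H : hilbertType R) (S T : bop H) : S =1 T -> S = T.
Proof. by move=> ST; apply/val_inj/funext. Qed.

Lemma bopD (H : hilbertType R) (S T : bop H) u : (S + T) u = S u + T u.
Proof. by []. Qed.

Lemma bopB (H : hilbertType R) (S T : bop H) u : (S - T) u = S u - T u.
Proof. by []. Qed.

Lemma bopZ (H : hilbertType R) (a : R[i]) (S : bop H) u : (a *: S) u = a *: S u.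
Proof. by []. Qed.

Lemma bop_linear (H : hilbertType R) (S : bop H) : linear S.
Proof. by have /asboolP[] := valP S. Qed.

Lemma bop_scale (H : hilbertType R) (S : bop H) (a : R[i]) v :
  S (a *: v) = a *: S v.
Proof. exact: (GRing.scalable_linear (bop_linear S)). Qed.

Lemma bop_sumE (H : hilbertType R) (I : Type) (s : seq I) (F : I -> bop H) v :
  (\sum_(i <- s) F i) v = \sum_(i <- s) F i v.
Proof. by elim/big_rec2: _ => //= i u S _ <-. Qed.

Section CompletelyPositive.
Context (H : hilbertType R).

(** Kraus form of a completely positive map. Moving [S i] across the inner product turns the block
    form at the vectors [x j] into a combination, with weights [c i >= 0], of the block forms of [T]
    at the vectors [V i (x j)]. *)
Lemma ucp_sandwich (I : finType) (c : I -> R) (S V : I -> bop H) :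
  (forall i, 0 <= c i) -> (forall i, is_adjoint (S i) (V i)) ->
  \sum_i (c i)%:C%C *: bopM (S i) (V i) = bop1 H ->
  ucp (fun T => \sum_i (c i)%:C%C *: bopM (S i) (bopM T (V i))).
Proof.
move=> c0 SV SV1; split.
- move=> a T U; rewrite scaler_sumr -big_split/=; apply: eq_bigr => i _.
  rewrite scalerA mulrC -scalerA -scalerDr; congr (_ *: _).
  by apply: bop_eq => v; rewrite /= [LHS](bop_linear (S i)).
- by rewrite -[RHS]SV1; apply: eq_bigr => i _; congr (_ *: _); apply: bop_eq.
move=> m T Tp x.
set L := (X in 0 <= X).
suff -> : L = \sum_i (c i)%:C%C *
    \sum_j \sum_k hdot H (T j k (V i (x k))) (V i (x j)).
  by apply: sumr_ge0 => i _; rewrite mulr_ge0 ?ler0c// Tp.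
transitivity (\sum_i \sum_j \sum_k
    (c i)%:C%C * hdot H (T j k (V i (x k))) (V i (x j))); last first.
  by apply: eq_bigr => i _; rewrite mulr_sumr; apply: eq_bigr => j _;
    rewrite mulr_sumr.
rewrite [RHS]exchange_big/=; apply: eq_bigr => j _.
rewrite [RHS]exchange_big/=; apply: eq_bigr => k _.
rewrite mxE bop_sumE linear_sumlz; apply: eq_bigr => i _.
by rewrite -SV linearZl_LR.
Qed.

End CompletelyPositive.

End BoundedOperatorConstructions.

Section SquareSummableOperators.
Context (R : realType) (T : choiceType).
Local Notation l2 := (l2 R T).
Implicit Types (u v w : l2) (x y : T) (a b : T -> R[i]).

Lemma l2D u v x : (u + v) x = u x + v x. Proof. by []. Qed.

Lemma l2B u v x : (u - v) x = u x - v x. Proof. by []. Qed.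

Lemma l2Z (k : R[i]) u x : (k *: u) x = k * u x. Proof. by []. Qed.

Lemma l2_sumE (I : Type) (s : seq I) (F : I -> l2) x :
  (\sum_(i <- s) F i) x = \sum_(i <- s) F i x.
Proof. by elim/big_rec2: _ => //= i u v _ <-. Qed.

Fact l2_dotE u : `|u| ^+ 2 = l2dot u u.
Proof. by rewrite rnormE -rmorphXn l2norm_sqr l2dot_sqsum. Qed.

Definition l2_hilbert : hilbertType R := HilbertType l2_dotE.

Definition norm_bounded a := exists c : R, forall x, rnorm (a x) <= c.

Lemma psum_mul_le a u (c : R) A : (forall x, rnorm (a x) <= c) ->
  psum (a * u) A <= (c * rnorm u) ^+ 2.
Proof.
move=> ac; apply: (@le_trans _ _ (c ^+ 2 * psum u A)).
  rewrite /psum mulr_sumr; apply: ler_sum => x _.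
  rewrite rnormM exprMn ler_wpM2r ?sqr_ge0// ler_sqr ?nnegrE ?rnorm_ge0//.
  exact: le_trans (rnorm_ge0 (a x)) (ac x).
by rewrite exprMn ler_wpM2l ?sqr_ge0// rnorm_l2 l2norm_sqr psum_le ?l2E.
Qed.

Fact mul_l2 a u : norm_bounded a -> a * u \in @is_l2 R T.
Proof. by case=> c ac; apply: is_l2P => A; exact: psum_mul_le ac. Qed.

Fact mul_l2_bop a (ba : norm_bounded a) :
  (fun u : l2 => L2 (mul_l2 u ba)) \in @is_bop R l2_hilbert.
Proof.
have [c ac] := ba.
(* The bound [c] can be negative when [T] is empty, hence [|c|]. *)
apply: (@bounded_is_bop _ _ _ `|c|) => [d u v|u].
  by apply: l2_eq => x /=; rewrite !fctE/= mulrDr mulrCA.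
rewrite -ler_sqr ?nnegrE ?mulr_ge0 ?rnorm_ge0// l2norm_sqr.
by apply: sqsum_le => A; apply: psum_mul_le => x; exact: le_trans (ler_norm _).
Qed.

Definition mulop a (ba : norm_bounded a) : bop l2_hilbert :=
  Bop (mul_l2_bop ba).

Lemma mulopE a (ba : norm_bounded a) u x : (mulop ba u : l2) x = a x * u x.
Proof. by []. Qed.

Lemma mulop_adjoint a b (ba : norm_bounded a) (bb : norm_bounded b) :
  (forall x, a x = (b x)^*) -> is_adjoint (mulop ba) (mulop bb).
Proof.
move=> ab u v; apply: l2dot_ext => x.
by rewrite /= !fctE ab rmorphM/= mulrCA mulrA.
Qed.

Fact delta_l2 x : (fun y => (y == x)%:R) \in @is_l2 R T.
Proof.
apply: (@is_l2P _ _ _ 1) => A; rewrite /psum.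
have [xA|xA] := boolP (x \in A).
  rewrite (big_fsetD1 x)//= eqxx rnorm1 expr1n big1_fset ?addr0// => y.
  by rewrite !inE => /andP[/negPf-> _] _; rewrite rnorm0 expr0n.
rewrite big1_fset ?ler01// => y yA _; case: eqP => [yx|_].
  by rewrite -yx yA in xA.
by rewrite rnorm0 expr0n.
Qed.

Definition delta x : l2 := L2 (delta_l2 x).

Lemma deltaE x y : delta x y = (y == x)%:R. Proof. by []. Qed.

Lemma l2dot_delta u x : l2dot u (delta x) = u x.
Proof.
have FF := @totally_filter T.
(* Eventually along [totally] the finite set contains [x], and from then on the sum reduces to its
   term at [x]. *)
have Fx : totally [set A | ([fset x] `<=` A)%fset] by exists [fset x]%fset.
apply: l2dot_eq; apply: cvg_near_cst; apply: filterS Fx => A /= xA.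
have {}xA : x \in A by apply: (fsubsetP xA); rewrite inE.
rewrite (big_fsetD1 x)//= eqxx conjC1 mulr1 big1_fset ?addr0// => y.
by rewrite !inE => /andP[/negPf-> _] _; rewrite conjC0 mulr0.
Qed.

Lemma l2norm_delta x : l2norm (delta x) = 1.
Proof.
rewrite /l2norm (_ : sqsum _ = 1) ?sqrtr1//; apply: complexI.
by rewrite -l2dot_sqsum l2dot_delta/= eqxx.
Qed.

Fact swap_bop x y :
  (fun u : l2 => u y *: delta x) \in @is_bop R l2_hilbert.
Proof.
apply: (@bounded_is_bop _ _ _ 1) => [d u v|u].
  by rewrite /= !fctE scalerDl scalerA.
rewrite rnormZ [X in _ * X]l2norm_delta mulr1 mul1r.
exact: coord_le_rnorm.
Qed.

(** The matrix unit that sends [delta y] to [delta x] and kills the other basis vectors. *)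
Definition swapop x y : bop l2_hilbert := Bop (swap_bop x y).

Lemma swapopE x y u : swapop x y u = u y *: delta x.
Proof. by []. Qed.

Lemma swapop_adjoint x y : is_adjoint (swapop x y) (swapop y x).
Proof.
move=> u v; rewrite /= linearZl_LR linearZr_LR/= l2dot_delta.
by rewrite l2dotC l2dot_delta mulrC.
Qed.

End SquareSummableOperators.

(** * Stone-Weierstrass theorem *)

Section PointwiseOperations.
Context (R : realType) (K : topologicalType).
Implicit Types (f g : cfun R K) (x : K).

Lemma cfunD f g x : (f + g) x = f x + g x. Proof. by []. Qed.

Lemma cfunB f g x : (f - g) x = f x - g x. Proof. by []. Qed.

Lemma cfunZ (a : R[i]) f x : (a *: f) x = a * f x. Proof. by []. Qed.

Lemma cfunM f g x : (f * g) x = f x * g x. Proof. by []. Qed.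

Lemma cfun1 x : (1 : cfun R K) x = 1. Proof. by []. Qed.

Lemma cfunX f n x : (f ^+ n) x = f x ^+ n.
Proof. by elim: n => [|n IHn]; rewrite ?cfun1// !exprS cfunM IHn. Qed.

Lemma cfun_conjE f x : cfun_conj f x = (f x)^*. Proof. by []. Qed.

End PointwiseOperations.

Section SupNorm.
Context (R : realType) (K : topologicalType).
Context (compactK : compact [set: K]).
Implicit Types f g : cfun R K.

Lemma cfun_bounded f : exists c : R, forall x, rnorm (f x) <= c.
Proof.
have nf : continuous (fun x => rnorm (f x)).
  by move=> x; apply: cvg_rnorm; exact: cts_fun.
have [c [_ cP]] : bounded_set ((fun x => rnorm (f x)) @` [set: K]).
  apply: compact_bounded; apply: continuous_compact compactK.
  exact: continuous_subspaceT.
exists (c + 1) => x; have := cP (c + 1); rewrite ltrDl ltr01 => /(_ isT).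
by move=> /(_ (rnorm (f x))) /=; rewrite ger0_norm ?rnorm_ge0//; apply; exists x.
Qed.

Lemma rnorm_le_supnorm f x : rnorm (f x) <= supnorm f.
Proof.
apply: ub_le_sup; last by exists x.
by have [c fc] := cfun_bounded f; exists c => _ [y _ <-].
Qed.

Lemma supnorm_le f (x0 : K) (c : R) :
  (forall x, rnorm (f x) <= c) -> supnorm f <= c.
Proof.
move=> fc; apply: ge_sup => [|_ [x _ <-]//].
by exists (rnorm (f x0)); exists x0.
Qed.

End SupNorm.

Section AbsoluteValueApproximation.
Context (R : realType).

(** Iteration for the square root of [t ^+ 2]: polynomials in [t] which, for [|t| <= 1], increase
    from 0 to [|t|]. Being polynomials, they stay in any algebra that contains [t]. *)
Fixpoint abs_approx (t : R) (n : nat) : R :=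
  if n is m.+1 then abs_approx t m + 2^-1 * (t ^+ 2 - abs_approx t m ^+ 2)
  else 0.

(* The error [e] satisfies
   [e' = e * (1 - (|t| + p) / 2) <= e * (1 - |t| / 2)]. *)
Lemma abs_approxP (t : R) n : `|t| <= 1 ->
  [/\ 0 <= abs_approx t n, abs_approx t n <= `|t| &
      (`|t| - abs_approx t n) * (1 + n%:R * (`|t| / 2)) <= `|t|].
Proof.
move=> t1.
have t0 := normr_ge0 t.
elim: n => [|n [p0 pt IH]] /=.
  by rewrite subr0 mul0r addr0 mulr1.
rewrite -[t ^+ 2]real_normK ?num_real//.
move: p0 pt IH; set p := abs_approx t n; move: t0 t1; move: (`|t|) p => s p.
move=> s0 s1 p0 ps IH.
have n0 : 0 <= n%:R :> R by [].
split.
- have : p ^+ 2 <= s ^+ 2 by rewrite ler_sqr ?nnegrE.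
  by nra.
- by nra.
- rewrite (_ : n.+1%:R = n%:R + 1); last by rewrite natr1.
  set m := n%:R in IH n0 *.
  apply: le_trans IH.
  rewrite (_ : s - _ = (s - p) * (1 - (s + p) / 2)); last by field.
  rewrite -mulrA ler_wpM2l ?subr_ge0//.
  (* What remains is [(1 - (s + p) / 2) * (1 + (m + 1) * (s / 2)) <= 1 + m * (s / 2)]; the gap is a
     positive combination of the quantities in [h1] and [h2]. *)
  have h1 : 0 <= p * (1 + (m + 1) * (s / 2)).
    by rewrite mulr_ge0// addr_ge0// mulr_ge0 ?divr_ge0// addr_ge0.
  have h2 : 0 <= (m + 1) * s ^+ 2 by rewrite mulr_ge0 ?sqr_ge0// addr_ge0.
  clearbody m; rewrite -subr_ge0 (_ : _ - _ = (m + 1) * s ^+ 2 / 4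
    + p * (1 + (m + 1) * (s / 2)) / 2); last by field.
  by rewrite addr_ge0// divr_ge0.
Qed.

(** Dropping the 1 in the third bound of [abs_approxP] and dividing by [|t|] leaves an error of at
    most [2 / n], uniformly in [t]; at [t = 0] the error vanishes. *)
Lemma abs_approx_err (t : R) n : `|t| <= 1 ->
  `| `|t| - abs_approx t n| * n%:R <= 2.
Proof.
move=> /(abs_approxP n)[p0 ps]; rewrite (@ger0_norm _ (`|t| - _)) ?subr_ge0//.
suff h (s p m : R) : 0 <= p <= s -> 0 <= m ->
    (s - p) * (1 + m * (s / 2)) <= s -> (s - p) * m <= 2.
  by apply: h => //; rewrite p0.
move=> {p0 ps}/andP[p0 ps] m0; have [s0|s0] := leP s 0.
  move=> _; have -> : s = p by apply: le_anti; rewrite ps (le_trans s0).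
  by rewrite subrr mul0r.
move=> h; rewrite -(ler_pM2r s0); have : 0 <= s - p by rewrite subr_ge0.
by nra.
Qed.

End AbsoluteValueApproximation.

Section StoneWeierstrass.
Context (R : realType) (K : topologicalType) (x0 : K).
Context (compactK : compact [set: K]).
Context (B : set (cfun R K)).
Context (cstarB : cstar_subalgebra B) (B1 : B 1).
Context (sepB : forall x y : K, (forall f, B f -> f x = f y) -> x = y).
Implicit Types (u v : K -> R) (f g : cfun R K).

(** The lattice operations need an order, so the argument runs over real-valued functions, which
    meet the complex algebra [B] through the embedding of [R]. *)
Definition real_in u := exists2 f, B f & forall x, f x = (u x)%:C%C.

Lemma subalgZ (a : R[i]) f : B f -> B (a *: f).
Proof.
by case: cstarB => B0 BL _ _ _ Bf; rewrite -[_ *: _]addr0; exact: BL.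
Qed.

Lemma subalgD f g : B f -> B g -> B (f + g).
Proof.
by case: cstarB => B0 BL _ _ _ Bf Bg; rewrite -[f]scale1r; exact: BL.
Qed.

Lemma real_in_cst (c : R) : real_in (cst c).
Proof.
exists ((c%:C%C : R[i]) *: (1 : cfun R K)); first exact: subalgZ.
by move=> x; exact: mulr1.
Qed.

Lemma real_inD u v : real_in u -> real_in v -> real_in (u \+ v).
Proof.
move=> [f Bf fu] [g Bg gv]; exists (f + g); first exact: subalgD.
by move=> x; rewrite rmorphD/= -fu -gv.
Qed.

Lemma real_inM u v : real_in u -> real_in v -> real_in (u \* v).
Proof.
move=> [f Bf fu] [g Bg gv]; exists (f * g).
  by case: cstarB => _ _ + _ _; apply.
by move=> x; rewrite rmorphM/= -fu -gv.
Qed.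

Lemma real_inZ (c : R) u : real_in u -> real_in (fun x => c * u x).
Proof. by move=> /(real_inM (real_in_cst c)). Qed.

Lemma real_inB u v : real_in u -> real_in v -> real_in (u \- v).
Proof.
move=> Bu /(real_inZ (-1)) Bv; rewrite (_ : _ \- _ = u \+ (fun x => -1 * v x)).
  exact: real_inD.
by apply/funext => x /=; rewrite mulN1r.
Qed.

Lemma real_in_continuous u : real_in u -> continuous u.
Proof.
move=> [f _ fu] x; rewrite (_ : u = fun y => complex.Re (f y)).
  by apply: cvg_complexRe; exact: cts_fun.
by apply/funext => y; rewrite fu.
Qed.

Lemma real_in_closed u : continuous u ->
  (forall e : R, 0 < e -> exists2 v, real_in v & forall x, `|u x - v x| <= e) ->
  real_in u.
Proof.
move=> cu uv; have cuC : continuous (fun x => (u x)%:C%C : R[i]).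
  by move=> x; apply: cvg_realC; exact: cu.
exists (mkcts cuC) => //; case: cstarB => _ _ _ _; apply => e e0.
have e20 : 0 < e / 2 by rewrite divr_gt0.
have [v [g Bg gv] uve] := uv _ e20; exists g => //.
apply: (@le_lt_trans _ _ (e / 2)).
  by apply: (supnorm_le x0) => x; rewrite cfunB gv -rmorphB rnorm_real.
by rewrite ltr_pdivrMr// ltr_pMr// ltr1n.
Qed.

(** Rescaling by [|c| + 1] brings [u] into [[-1, 1]], where the polynomials [abs_approx] converge
    uniformly to the absolute value; closedness of [B] concludes. *)
Lemma real_in_norm u : real_in u -> real_in (fun x => `|u x|).
Proof.
move=> Bu; have [f Bf fu] := Bu; have [c fc] := cfun_bounded compactK f.
have c10 : 0 < `|c| + 1 by rewrite ltr_wpDl.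
pose t x := (`|c| + 1)^-1 * u x.
have t1 x : `|t x| <= 1.
  rewrite normrM gtr0_norm ?invr_gt0// ler_pdivrMl// mulr1.
  rewrite -(rnorm_real (u x)) -fu (le_trans (fc x))// (le_trans (ler_norm c))//.
  by rewrite lerDl.
have Bt : real_in t by exact: real_inZ.
have Bp n : real_in (fun x => abs_approx (t x) n).
  elim: n => [|n IH]; first exact: real_in_cst.
  by apply: real_inD => //; apply/real_inZ/real_inB; exact: real_inM.
have -> : (fun x => `|u x|) = fun x => (`|c| + 1) * `|t x|.
  apply/funext => x; rewrite normrM gtr0_norm ?invr_gt0//.
  by rewrite mulrA divff ?mul1r ?gt_eqF.
apply: real_inZ; apply: real_in_closed => [x|e e0].
  by apply: cvg_norm; exact: real_in_continuous Bt x.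
(* This makes [2 / e < n], so that the error [2 / n] is below [e]. *)
pose n := (Num.truncn (2 / e)).+1.
exists (fun x => abs_approx (t x) n) => // x.
have n0 : 0 < n%:R :> R by [].
rewrite -(ler_pM2r n0); apply: le_trans (abs_approx_err n (t1 x)) _.
by rewrite mulrC -ler_pdivrMr// ltW// truncnS_gt.
Qed.

Lemma real_in_max u v : real_in u -> real_in v ->
  real_in (fun x => Num.max (u x) (v x)).
Proof.
move=> Bu Bv.
rewrite (_ : (fun x => _) = fun x => 2^-1 * ((u x + v x) + `|u x - v x|)).
  by apply: real_inZ; apply: real_inD; [exact: real_inD|
    apply: real_in_norm; exact: real_inB].
by apply/funext => x; rewrite maxr_absE mulrC.
Qed.

Lemma real_in_min u v : real_in u -> real_in v ->
  real_in (fun x => Num.min (u x) (v x)).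
Proof.
move=> Bu Bv.
rewrite (_ : (fun x => _) = fun x => 2^-1 * ((u x + v x) - `|u x - v x|)).
  by apply: real_inZ; apply: real_inB; [exact: real_inD|
    apply: real_in_norm; exact: real_inB].
by apply/funext => x; rewrite minr_absE mulrC.
Qed.

Lemma real_in_Re f : B f -> real_in (fun x => complex.Re (f x)).
Proof.
move=> Bf; exists (2^-1 *: (f + cfun_conj f)).
  by apply/subalgZ/subalgD => //; case: cstarB => _ _ _ + _; apply.
by move=> x; rewrite ReJ_add mulrC.
Qed.

Lemma real_in_Im f : B f -> real_in (fun x => complex.Im (f x)).
Proof.
move=> Bf; rewrite (_ : (fun x => _) = fun x => complex.Re (((- 'i%C) *: f) x)).
  by apply: real_in_Re; exact: subalgZ.
by apply/funext => x; rewrite cfunZ; case: (f x) => a b /=; ring.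
Qed.

(** If [x] and [y] differ, some [f] in [B] separates them, hence so does its real or imaginary part
    [u]; an affine function of [u] then takes the two prescribed values. *)
Lemma real_in_interpolation (h : K -> R) x y :
  exists2 u, real_in u & u x = h x /\ u y = h y.
Proof.
have [->|xy] := pselect (x = y).
  by exists (cst (h y)) => //; exact: real_in_cst.
have [u Bu uxy] : exists2 u, real_in u & u x <> u y.
  apply/not_exists2P => uxy; apply: xy; apply: sepB => f Bf.
  rewrite [f x]complexE [f y]complexE.
  have [|/contrapT->] := uxy (fun x => complex.Re (f x)).
    by move=> /(_ (real_in_Re Bf)).
  have [|/contrapT->//] := uxy (fun x => complex.Im (f x)).
  by move=> /(_ (real_in_Im Bf)).
have d0 : u y - u x != 0 by rewrite subr_eq0; apply/eqP => /esym.
exists (fun z => h x + (h y - h x) / (u y - u x) * (u z - u x)).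
  apply: real_inD; first exact: real_in_cst.
  by apply/real_inZ/real_inB => //; exact: real_in_cst.
by split; [rewrite subrr mulr0 addr0|rewrite divfK// addrC subrK].
Qed.

(* The tails of a directed family form a proper filter, along which a near
   cover of a compact space holds uniformly. *)
Lemma compact_directed (I : Type) (D : set I) (le : I -> I -> Prop)
    (P : I -> K -> Prop) :
  (forall i, le i i) -> (forall i j k, le i j -> le j k -> le i k) ->
  D !=set0 ->
  (forall i j, D i -> D j -> exists k, [/\ D k, le k i & le k j]) ->
  (forall x : K, exists2 i, D i &
     \forall y \near x, forall j, D j -> le j i -> P j y) ->
  exists2 i, D i & forall x, P i x.
Proof.
move=> le_refl le_trans D0 Ddir Dloc.
pose F := filter_from D (fun i => [set j | D j /\ le j i]).
have FF : ProperFilter F.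
  apply: filter_from_proper; last by move=> i Di; exists i.
  apply: filter_from_filter => // i j Di Dj.
  have [k [Dk ki kj]] := Ddir _ _ Di Dj.
  by exists k => // l [Dl lk]; split; split=> //; apply: le_trans lk _.
have FD : F D by case: D0 => i Di; exists i => // j [].
have /compact_near_coveringP/(_ I F P FF) FP := compactK.
have {}FP : \forall i \near F, [set: K] `<=` P i.
  apply: FP => x _; have [i Di xP] := Dloc x.
  exists ([set y | forall j, D j -> le j i -> P j y], [set j | D j /\ le j i]).
    by split=> //; exists i.
  by move=> [y j] /= [yP [Dj ji]]; exact: yP.
have [i [Di iP]] := filter_ex (filterI FD FP).
by exists i => // x; exact: iP.
Qed.

Lemma continuous_near_lt (u v : K -> R) x : continuous u -> continuous v ->
  u x < v x -> \forall y \near x, u y < v y.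
Proof.
move=> cu cv uv; have /cvgr_gt : (v \- u) y @[y --> x] --> v x - u x.
  by apply: cvgB; [exact: cv|exact: cu].
by move=> /(_ 0); rewrite subr_gt0 => /(_ uv); apply: filterS => y;
  rewrite subr_gt0.
Qed.

(** Two compactness arguments. For fixed [x], minima of two-point interpolants of [h] produce a
    function through [h x] lying below [h + e]. Maxima of such functions over varying [x] then rise
    above [h - e] while staying below [h + e]. *)
Lemma real_in_approx (h : K -> R) (e : R) : continuous h -> 0 < e ->
  exists2 u, real_in u & forall x, `|h x - u x| <= e.
Proof.
move=> ch e0.
have above x : exists2 u, real_in u /\ u x = h x & forall y, u y < h y + e.
  apply: (@compact_directed _ _ (fun u v => forall y, u y <= v y)
      (fun u y => u y < h y + e)) => //.
  - by move=> u v w uv vw y; exact: le_trans (uv y) (vw y).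
  - by have [u Bu [ux _]] := real_in_interpolation h x x; exists u.
  - move=> u v [Bu ux] [Bv vx]; exists (fun y => Num.min (u y) (v y)); split.
    + by split; [exact: real_in_min|rewrite ux vx minxx].
    + by move=> y; rewrite ge_min lexx.
    + by move=> y; rewrite ge_min lexx orbT.
  move=> y; have [u Bu [ux uy]] := real_in_interpolation h x y; exists u => //.
  have : \forall z \near y, u z < (h \+ cst e) z.
    apply: continuous_near_lt; last by rewrite /= uy ltrDl.
      exact: real_in_continuous.
    by move=> z; apply: cvgD; [exact: ch|exact: cvg_cst].
  by apply: filterS => z uz v _ vu; exact: le_lt_trans (vu z) uz.
(* The order is now reversed: the family is directed upwards by [max], and near [y] the function
   given by [above y] exceeds [h - e] because it agrees with [h] at [y]. *)
have [u [Bu uh] hu] : exists2 u, real_in u /\ (forall y, u y < h y + e) &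
    forall y, h y - e < u y.
  apply: (@compact_directed _ _ (fun u v => forall y, v y <= u y)
      (fun u y => h y - e < u y)) => //.
  - by move=> u v w uv vw y; exact: le_trans (vw y) (uv y).
  - by have [u [Bu _] uh] := above x0; exists u.
  - move=> u v [Bu uh] [Bv vh]; exists (fun y => Num.max (u y) (v y)); split.
    + by split; [exact: real_in_max|move=> y; rewrite gt_max uh vh].
    + by move=> y; rewrite le_max lexx.
    + by move=> y; rewrite le_max lexx orbT.
  move=> y; have [u [Bu uy] uh] := above y; exists u => //.
  have : \forall z \near y, (h \- cst e) z < u z.
    apply: continuous_near_lt; last by rewrite /= uy ltrBlDr ltrDl.
      by move=> z; apply: cvgB; [exact: ch|exact: cvg_cst].
    exact: real_in_continuous.
  by apply: filterS => z uz v _ vu; exact: lt_le_trans uz (vu z).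
exists u => // x; have ux := uh x; have xu := hu x.
by rewrite ler_norml; apply/andP; split; lra.
Qed.

Lemma real_in_all (h : K -> R) : continuous h -> real_in h.
Proof. by move=> ch; apply: real_in_closed => // e; exact: real_in_approx. Qed.

Theorem stone_weierstrass : B = [set: cfun R K].
Proof.
apply/seteqP; split=> // f _.
have cRe : continuous (fun x => complex.Re (f x)).
  by move=> x; apply: cvg_complexRe; exact: cts_fun.
have cIm : continuous (fun x => complex.Im (f x)).
  by move=> x; apply: cvg_complexIm; exact: cts_fun.
have [g Bg gE] := real_in_all cRe; have [k Bk kE] := real_in_all cIm.
rewrite (_ : f = g + 'i%C *: k); first by apply: subalgD => //; exact: subalgZ.
by apply/val_inj/funext => x /=; rewrite [LHS]complexE -gE -kE.
Qed.

End StoneWeierstrass.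

(** * Averages of evaluations *)

Section RepresentingWeights.
Context (R : realType) (K : topologicalType).
Context (compactK : compact [set: K]).
Context (x1 : K) (I : finType) (P : I -> K).
Implicit Types (c : I -> R) (f g : cfun R K) (M : set (cfun R K)).

Definition average c f : R[i] := \sum_i (c i)%:C%C * f (P i).

(** Nonnegative weights of sum 1 make the functional bounded by the sup norm, which gives continuity
    with [d = e] and norm at most 1; the constant function 1 attains the norm. *)
Lemma average_state c M : (forall i, 0 <= c i) -> \sum_i c i = 1 -> M 1 ->
  state_space (fun f : M => average c (\val f)).
Proof.
move=> c0 c1 M1.
have cC : \sum_i (c i)%:C%C = 1 :> R[i] by rewrite -rmorph_sum c1.
have avg_le f : rnorm (average c f) <= supnorm f.
  apply: (@le_trans _ _ (\sum_i c i * rnorm (f (P i)))).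
    rewrite /average; elim/big_rec2: _ => [|i a b _ ab]; first by rewrite rnorm0.
    apply: le_trans (ler_rnormD _ _) _; apply: lerD => //.
    by rewrite rnormM rnorm_real ger0_norm.
  rewrite -[leRHS]mul1r -c1 mulr_suml; apply: ler_sum => i _.
  by rewrite ler_wpM2l// rnorm_le_supnorm.
have avgB f g : average c f - average c g = average c (f - g).
  by rewrite /average -sumrB; apply: eq_bigr => i _; rewrite cfunB mulrBr.
have avg1 : average c 1 = 1.
  by rewrite /average -[RHS]cC; apply: eq_bigr => i _; rewrite cfun1 mulr1.
split.
- move=> a f g h fgh; rewrite /average fgh mulr_sumr -big_split/=.
  by apply: eq_bigr => i _; rewrite mulrDr mulrCA.
- by move=> f e e0; exists e => // g; rewrite avgB; apply: le_lt_trans.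
- by move=> f ->.
have sup1 : supnorm (1 : cfun R K) <= 1.
  by apply: (supnorm_le x1) => x; rewrite cfun1 rnorm1.
apply/eqP; rewrite eq_le; apply/andP; split.
  apply: ge_sup => [|_ [f f1 <-]]; last exact: le_trans (avg_le _) f1.
  by exists (rnorm (average c 1)), (SigSub (mem_set M1)) => //=; exact: sup1.
apply: ub_le_sup; first by exists 1 => _ [f f1 <-]; exact: le_trans (avg_le _) f1.
by exists (SigSub (mem_set M1)); rewrite /= ?avg1 ?rnorm1//; exact: sup1.
Qed.

Context (c : I -> R) (G : set (cfun R K)) (i0 : I) (g0 : cfun R K).
Context (c_ge0 : forall i, 0 <= c i) (c_sum : \sum_i c i = 1).
Context (averageG : forall g, G g -> average c g = g x1).
Context (Gg0 : G g0) (g0_i0 : g0 (P i0) != g0 x1) (c_i0 : 0 < c i0 < 1).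

Lemma average_lspan f : lspan ([set 1] `|` G) f -> average c f = f x1.
Proof.
move=> [m [a [g [gG ->]]]]; rewrite /average.
have sumE x : (\sum_j a j *: g j : cfun R K) x = \sum_j a j * g j x.
  by elim/big_rec2: _ => // j y h _ <-; rewrite cfunD cfunZ.
under eq_bigr => i _ do rewrite sumE mulr_sumr.
rewrite exchange_big sumE/=; apply: eq_bigr => j _.
under eq_bigr => i _ do rewrite mulrCA.
rewrite -mulr_sumr; congr (_ * _); have [->|/averageG//] := gG j.
under eq_bigr => i _ do rewrite cfun1 mulr1.
by rewrite -rmorph_sum c_sum.
Qed.

(** On [M], evaluation at [x1] is [c i0] times evaluation at [P i0] (weights [u]) plus [1 - c i0]
    times the average over the other indices, renormalized to total mass 1 (weights [w]).
    Extremality would identify the evaluations at [P i0] and [x1], which [g0] tells apart. *)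
Lemma not_choquet_boundary : ~ choquet_boundary (lspan ([set 1] `|` G)) x1.
Proof.
set M := lspan _; move=> [_ extr].
have span_sub f : ([set 1] `|` G) f -> M f.
  move=> Gf; exists 1%N, (fun=> 1), (fun=> f); split=> //.
  by rewrite big_ord1 scale1r.
have M1 : M 1 by apply: span_sub; left.
have Mg : M g0 by apply: span_sub; right.
have /andP[t0 t1] := c_i0.
have t1' : 0 < 1 - c i0 by rewrite subr_gt0.
pose u i : R := (i == i0)%:R.
pose w i : R := (1 - c i0)^-1 * (c i * (i != i0)%:R).
have u_sum : \sum_i u i = 1.
  by rewrite (bigD1 i0)//= /u eqxx big1 ?addr0// => i /negPf ->.
have w_sum : \sum_i w i = 1.
  rewrite -mulr_sumr (bigD1 i0)//= eqxx mulr0 add0r.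
  rewrite (_ : \sum_(i | i != i0) _ = 1 - c i0) ?mulVf ?gt_eqF//.
  rewrite -[X in _ = X - _]c_sum [in RHS](bigD1 i0)//= [c i0 + _]addrC addrK.
  by apply: eq_bigr => i ->; rewrite mulr1.
have uS : state_space (fun f : M => average u (\val f)).
  by apply: average_state => // i; rewrite /u ler0n.
have wS : state_space (fun f : M => average w (\val f)).
  apply: average_state => // i.
  apply: mulr_ge0; first by rewrite invr_ge0 ltW.
  by apply: mulr_ge0; [exact: c_ge0|exact: ler0n].
have avg_u f : average u f = f (P i0).
  rewrite /average (bigD1 i0)//= /u eqxx mul1r big1 ?addr0// => i /negPf ->.
  by rewrite mul0r.
have [|/(congr1 (fun L => L (SigSub (mem_set Mg))))/= ug _] :=
    extr _ _ _ uS wS c_i0.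
  apply/funext => f; rewrite -average_lspan; last exact: set_valP.
  transitivity ((c i0)%:C%C * average u (\val f) +
    (1 - c i0)%:C%C * average w (\val f)); last by [].
  rewrite avg_u /average [LHS](bigD1 i0)//= [in RHS](bigD1 i0)//=.
  rewrite /w eqxx !mulr0 mul0r add0r; congr (_ + _).
  rewrite mulr_sumr; apply: eq_bigr => i ->.
  by rewrite mulrA mulr1 -rmorphM/= mulrA divff ?mul1r// gt_eqF.
by move/eqP: g0_i0; apply; rewrite -avg_u.
Qed.

Local Notation H := (l2_hilbert R K).

(** The space is l2 for the counting measure on [K], whatever its topology: every point has a basis
    vector, so the representation is faithful and the values of [f] are its diagonal entries. *)
Definition mul_rep f : bop H := mulop (cfun_bounded compactK f).

Lemma mul_repE f (u : H) x : l2_fun (mul_rep f u) x = f x * l2_fun u x.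
Proof. by []. Qed.

Lemma mul_rep_representation : representation mul_rep.
Proof.
split.
- move=> a f g; apply: bop_eq => u; apply: l2_eq => x.
  by rewrite bopD bopZ l2D l2Z !mul_repE cfunD cfunZ mulrDl mulrA.
- by apply: bop_eq => u; apply: l2_eq => x; rewrite mul_repE cfun1 mul1r.
- move=> f g; apply: bop_eq => u; apply: l2_eq => x.
  by rewrite !mul_repE cfunM mulrA.
- by move=> f; exact: mulop_adjoint.
Qed.

Lemma mul_rep_inj : injective mul_rep.
Proof.
move=> f g fg; apply/val_inj/funext => x.
have : l2_fun (mul_rep f (delta R x)) x = l2_fun (mul_rep g (delta R x)) x.
  by rewrite fg.
by rewrite !mul_repE deltaE eqxx !mulr1.
Qed.

(** The norm is attained at [delta x]. This converts operator norms of corner defects into absolute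
    values of numbers. *)
Lemma opnorm_swapop (a : R[i]) (x : K) : opnorm (a *: swapop R x x) = rnorm a.
Proof.
have nE u : rnorm ((a *: swapop R x x) u) = rnorm a * rnorm (l2_fun u x).
  by rewrite bopZ swapopE !rnormZ [X in _ * (_ * X)]l2norm_delta mulr1.
have le_a u : rnorm u <= 1 -> rnorm ((a *: swapop R x x) u) <= rnorm a.
  move=> u1; rewrite nE ler_piMr ?rnorm_ge0//.
  exact: le_trans (coord_le_rnorm u x) u1.
apply/eqP; rewrite eq_le; apply/andP; split.
  apply: ge_sup => [|_ [u u1 <-]]; last exact: le_a.
  by exists (rnorm ((a *: swapop R x x) 0)), 0; rewrite //= rnorm0.
apply: ub_le_sup; first by exists (rnorm a) => _ [u u1 <-]; exact: le_a.
exists (delta R x); first by rewrite /= rnorm_l2 l2norm_delta.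
by rewrite nE deltaE eqxx rnorm1 mulr1.
Qed.

Let off_x1 x : R[i] := (x != x1)%:R.

Fact off_x1_bounded : norm_bounded off_x1.
Proof.
by exists 1 => x; rewrite /off_x1; case: eqP; rewrite ?rnorm0 ?rnorm1.
Qed.

(** Kraus operators of [corner_map]. The summand ['I_1] carries the projection away from [delta x1],
    with weight 1; index [i] carries the matrix units that move the diagonal entry at [P i] to [x1],
    with weight [c i]. *)
Let S (k : 'I_1 + I) : bop H :=
  if k is inr i then swapop R x1 (P i) else mulop off_x1_bounded.
Let V (k : 'I_1 + I) : bop H :=
  if k is inr i then swapop R (P i) x1 else mulop off_x1_bounded.
Let c' (k : 'I_1 + I) : R := if k is inr i then c i else 1.

(* [T] is compressed to the orthogonal complement of [delta x1], while the
   corner [<T delta_x1, delta_x1>] is replaced by the average of the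
   [<T delta_(P i), delta_(P i)>]. *)
Definition corner_map (T : bop H) : bop H :=
  \sum_k (c' k)%:C%C *: bopM (S k) (bopM T (V k)).

Lemma corner_mapE (T : bop H) u x : l2_fun (corner_map T u) x =
  off_x1 x * l2_fun (T (mulop off_x1_bounded u)) x +
  (\sum_i (c i)%:C%C * l2_fun (T (delta R (P i))) (P i)) * l2_fun u x1
    * (x == x1)%:R.
Proof.
rewrite bop_sumE l2_sumE big_sumType big_ord1; congr (_ + _).
  by rewrite bopZ l2Z mul1r.
rewrite -mulrA mulr_suml; apply: eq_bigr => i _.
rewrite bopZ l2Z -mulrA; congr (_ * _).
transitivity (l2_fun (T (l2_fun u x1 *: delta R (P i))) (P i) * (x == x1)%:R).
  by [].
by rewrite bop_scale l2Z mulrAC mulrC mulrA.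
Qed.

Lemma corner_map_ucp : ucp corner_map.
Proof.
apply: ucp_sandwich => [[k|i]|[k|i]|].
- by [].
- exact: c_ge0.
- by apply: mulop_adjoint => x; rewrite conjC_nat.
- exact: swapop_adjoint.
(* Unitality is read off [corner_mapE] at the identity: the projection is 1 away from [x1], and the
   corner receives the total weight 1. *)
have -> : \sum_k (c' k)%:C%C *: bopM (S k) (V k) = corner_map (bop1 H).
  by apply: eq_bigr => k _; congr (_ *: _); apply: bop_eq.
apply: bop_eq => u; apply: l2_eq => x; rewrite corner_mapE.
rewrite mulopE -/(l2_fun u) /off_x1.
under eq_bigr => i _ do rewrite deltaE eqxx mulr1.
rewrite -rmorph_sum c_sum mul1r.
by case: eqP => [->|_]; rewrite /= ?mul0r ?add0r ?mul1r ?mulr1// mulr0 addr0.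
Qed.

(** Multiplication operators are diagonal, so compressing them loses nothing and only the entry at
    [x1] changes. *)
Lemma corner_map_mul_rep f :
  corner_map (mul_rep f) - mul_rep f = (average c f - f x1) *: swapop R x1 x1.
Proof.
apply: bop_eq => u; apply: l2_eq => x.
rewrite bopB bopZ swapopE l2B !l2Z corner_mapE deltaE !mul_repE mulopE.
rewrite (_ : \sum_i _ = average c f); last first.
  by apply: eq_bigr => i _; rewrite mul_repE deltaE eqxx mulr1.
rewrite /off_x1; case: eqP => [->|_]; first by rewrite mul0r add0r !mulr1 mulrBl.
by rewrite !mulr0 addr0 !mul1r subrr.
Qed.

(** The constant sequence [corner_map] fixes the image of [G], so hyperrigidity would make it fix
    every [mul_rep f]. It fails for [f = |g0 - g0 x1|^2], which vanishes at [x1] but has positive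
    average, since the weight at [P i0] is positive and [f] is nonzero there. *)
Lemma not_hyperrigid : ~ hyperrigid G.
Proof.
move=> hyp; pose h : cfun R K := g0 - g0 x1 *: (1 : cfun R K).
have hE x : (cfun_conj h * h) x = `|g0 x - g0 x1| ^+ 2.
  by rewrite cfunM cfun_conjE normCKC /h cfunB cfunZ cfun1 mulr1.
move: (cfun_conj h * h) hE => f hE.
have lim0 : opnorm (corner_map (mul_rep f) - mul_rep f) @[_ --> \oo]
    --> (0 : R).
  apply: (hyp H mul_rep mul_rep_representation mul_rep_inj (fun=> corner_map)
    (fun=> corner_map_ucp)) => g Gg.
  rewrite corner_map_mul_rep averageG// subrr opnorm_swapop rnorm0.
  exact: cvg_cst.
have : average c f - f x1 = 0.
  apply: rnorm_eq0; rewrite -(opnorm_swapop _ x1) -corner_map_mul_rep.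
  by rewrite -(cvg_lim (@norm_hausdorff _ R) lim0) lim_cst.
rewrite hE subrr normr0 expr0n/= subr0 => avg0.
have /andP[c0 _] := c_i0.
have : 0 < average c f.
  rewrite /average (bigD1 i0)//= ltr_pwDl//.
    by rewrite hE mulr_gt0 ?ltcR// exprn_gt0// normr_gt0 subr_eq0.
  by apply: sumr_ge0 => i _; rewrite hE mulr_ge0 ?ler0c// exprn_ge0.
by rewrite avg0 ltxx.
Qed.

End RepresentingWeights.

(** Push the filter forward along [set_val]: a cluster point in [X] lifts, because neighbourhoods in
    [X] are traces of open sets. *)
Lemma compact_set_type (T : topologicalType) (X : set T) :
  compact X -> compact [set: X].
Proof.
move=> cX F FF _; have Xval (x : X) : X (set_val x) := set_valP x.
have [|p [Xp pF]] := cX (set_val @ F) _.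
  apply: (@filterS _ F _ setT) => [x _|]; first exact: (set_valP x).
  exact: filterT.
exists (SigSub (mem_set Xp)); split => // A B FA [_ [[C oC <-] Cp] CB].
have [|_ [[x Ax <-] Cx]] := pF (set_val @` A) C _ (open_nbhs_nbhs (conj oC Cp)).
  by apply: (@filterS _ F _ A) => // x Ax; exists x.
by exists x; split => //; exact: CB.
Qed.

(** * Roots of unity and monomials *)

Section RootsOfUnity.
Context (C : numClosedFieldType).
Implicit Types z : C.

(** In characteristic 0 the polynomial ['X^d - 1] is separable, so it has [d] distinct roots, and
    such a set of roots contains a primitive one. *)
Lemma prim_root_exists d : (0 < d)%N -> exists z, d.-primitive_root z.
Proof.
move=> d0; have [s sE] := closed_field_poly_normal ('X^d - 1 : {poly C}).
rewrite (monicP _) ?monicXnsubC// scale1r in sE.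
have /hasP[z _ zP] : has d.-primitive_root s; last by exists z.
apply: has_prim_root => //.
- by apply/allP => z; rewrite -root_prod_XsubC -sE.
- by rewrite -separable_prod_XsubC -sE separable_Xn_sub_1// pnatr_eq0 -lt0n.
- by rewrite -ltnS -(size_prod_XsubC s id) -sE size_XnsubC.
Qed.

Lemma sum_powers_root z d : z ^+ d = 1 ->
  \sum_(k < d) z ^+ k = if z == 1 then d%:R else 0.
Proof.
move=> zd; case: eqP => [->|/eqP z1].
  under eq_bigr do rewrite expr1n.
  by rewrite sumr_const card_ord.
apply/eqP; have := subrX1 z d; rewrite zd subrr => /esym/eqP.
by rewrite mulf_eq0 subr_eq0 (negPf z1).
Qed.

(** On the unit circle conjugation is inversion, so the left side is [z] to the power [q - p]; the
    sign of the exponent does not affect being 1. *)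
Lemma conj_expr_eq1 z p q : `|z| = 1 ->
  (z^* ^+ p * z ^+ q == 1) = (z ^+ `|q%:Z - p%:Z| == 1).
Proof.
move=> z1; have z0 : z != 0 by rewrite -normr_eq0 z1 oner_eq0.
have -> : z^* = z^-1 by rewrite invC_norm z1 expr1n invr1 mul1r.
have [pq|/ltnW qp] := leqP p q.
  by rewrite distnEl// -{1}(subnK pq) exprD mulrCA -exprMn mulVf// expr1n mulr1.
rewrite distnEr// -{1}(subnK qp) exprD -mulrA -exprMn mulVf// expr1n mulr1.
by rewrite exprVn invr_eq1.
Qed.

Lemma prim_root_norm z d : d.-primitive_root z -> `|z| = 1.
Proof.
move=> zP; have d0 := prim_order_gt0 zP.
by apply/eqP; rewrite -(@pexpr_eq1 _ _ d)// -normrX prim_expr_order ?normr1.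
Qed.

End RootsOfUnity.

Lemma expr_biggcd (F : fieldType) (I : finType) (d : I -> nat) (z : F) :
  (forall i, z ^+ d i = 1) -> z ^+ (\big[gcdn/0%N]_i d i) = 1.
Proof.
move=> zd; elim/big_ind: _ => // a b za zb.
have [a0|a0] := posnP a; first by rewrite a0 gcd0n.
(* Bezout over the naturals, available for [a > 0]: [u * a = v * b + gcdn a b]. *)
have [u v uv _] := egcdnP b a0.
have := congr1 (fun k => z ^+ k) uv; rewrite /= exprD.
by rewrite mulnC exprM za expr1n mulnC exprM zb expr1n mul1r.
Qed.

Section CstarClosure.
Context (R : realType) (K : topologicalType) (G : set (cfun R K)).

Lemma Cstar_subalgebra : cstar_subalgebra (Cstar G).
Proof.
split.
- by move=> B [[]].
- by move=> a f g Bf Bg B /[dup] BG [[_ + _ _ _] _]; apply; [exact: Bf|exact: Bg].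
- by move=> f g Bf Bg B /[dup] BG [[_ _ + _ _] _]; apply; [exact: Bf|exact: Bg].
- by move=> f Bf B /[dup] BG [[_ _ _ + _] _]; apply; exact: Bf.
move=> f Gf B /[dup] BG [[_ _ _ _ +] _]; apply => e /Gf[g Gg fg].
by exists g => //; exact: Gg.
Qed.

Lemma Cstar_gen f : G f -> Cstar G f.
Proof. by move=> Gf B [_]; apply; left. Qed.

Lemma Cstar1 : Cstar G 1.
Proof. by move=> B [_]; apply; right. Qed.

End CstarClosure.

Section Monomials.
Context (R : realType).
Implicit Types (z w : R[i]) (p q : nat).

Definition monomial p q z : R[i] := z^* ^+ p * z ^+ q.

Lemma monomialM p q z w :
  monomial p q (z * w) = monomial p q z * monomial p q w.
Proof. by rewrite /monomial rmorphM/= !exprMn mulrACA. Qed.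

Lemma monomialX p q z k : monomial p q (z ^+ k) = monomial p q z ^+ k.
Proof. by rewrite /monomial rmorphXn/= exprMn -!exprM ![(k * _)%N]mulnC. Qed.

Lemma monomial_real p q (t : R) :
  monomial p q t%:C%C = (t ^+ (p + q))%:C%C.
Proof.
rewrite /monomial [in X in X * _](_ : (t%:C%C)^* = t%:C%C).
  by rewrite -exprD rmorphXn.
by apply/CrealP; rewrite complex_real.
Qed.

Lemma norm_monomial p q z : `|monomial p q z| = `|z| ^+ (p + q).
Proof. by rewrite normrM !normrX norm_conjC exprD. Qed.

(** By multiplicativity this is [t ^+ (p + q)] times a geometric sum of powers of [monomial p q z],
    a [d]-th root of unity equal to 1 exactly when [d] divides [|q - p|]. *)
Lemma sum_monomial_circle p q d (t : R) z : d.-primitive_root z ->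
  \sum_(k < d) monomial p q (t%:C%C * z ^+ k) =
  if (d %| `|q%:Z - p%:Z|)%N then d%:R * (t ^+ (p + q))%:C%C else 0.
Proof.
move=> zP; have zN := prim_root_norm zP.
under eq_bigr => k _ do rewrite monomialM monomialX monomial_real.
rewrite -mulr_sumr sum_powers_root; last first.
  by rewrite -monomialX (prim_expr_order zP) /monomial conjC1 !expr1n mulr1.
rewrite conj_expr_eq1// -(prim_order_dvd zP).
by case: ifP => _; rewrite ?mulr0// mulrC.
Qed.

(** Comparing moduli gives [|z| = |w|]. For [w != 0] the quotient [z / w] is then unimodular and its
    [d j]-th powers are all 1, so its power with exponent the gcd, namely itself, is 1. *)
Lemma monomials_separate (I : finType) (p q d : I -> nat) z w :
  (forall j, 0 < d j)%N -> \big[gcdn/0%N]_j d j = 1%N ->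
  (forall j, d j = `|(q j)%:Z - (p j)%:Z|%N) -> (exists j : I, True) ->
  (forall j, monomial (p j) (q j) z = monomial (p j) (q j) w) -> z = w.
Proof.
move=> d0 dgcd dE [j0 _] zw.
have pq0 : (0 < p j0 + q j0)%N.
  have := d0 j0; rewrite dE !lt0n; apply: contraNneq => /eqP.
  by rewrite addn_eq0 => /andP[/eqP-> /eqP->].
have nzw : `|z| = `|w|.
  apply/eqP; rewrite -(eqrXn2 pq0)// -!norm_monomial.
  by rewrite zw.
have [w0|w0] := eqVneq w 0.
  by apply/eqP; rewrite w0 -normr_eq0 nzw w0 normr0.
have t1 : `|z / w| = 1 by rewrite normf_div nzw divff// normr_eq0.
have zE : z = w * (z / w) by rewrite mulrC divfK.
suff t : z / w = 1 by rewrite zE t mulr1.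
rewrite -[LHS]expr1 -dgcd; apply: expr_biggcd => j.
apply/eqP; rewrite dE -conj_expr_eq1//; apply/eqP.
have m0 : monomial (p j) (q j) w != 0.
  by rewrite mulf_neq0// expf_neq0// conjC_eq0.
by apply: (mulfI m0); rewrite mulr1 -[RHS]zw [in RHS]zE monomialM.
Qed.

End Monomials.

Lemma sum_tagged (V : nmodType) (I : finType) (J : I -> finType)
    (F : forall i, J i -> V) :
  \sum_(k : {i : I & J i}) F (tag k) (tagged k) = \sum_i \sum_j F i j.
Proof. by rewrite (sig_big_dep xpredT (fun=> xpredT)). Qed.

(** * The averaging points and the conclusions for the given monomials *)

Theorem proposition10p1 (R : realType) (n : nat) (hn : (2 <= n)%N)
  (d : 'I_n -> nat) (hd0 : forall j, (0 < d j)%N)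
  (hdvd : forall i j : 'I_n, i != j -> ~~ (d i %| d j)%N)
  (hgcd : \big[gcdn/0%N]_(j < n) d j = 1%N)
  (p q : 'I_n -> nat) (hpq : injective (fun j => (p j, q j)))
  (hd : forall j, d j = `|(q j)%:Z - (p j)%:Z|%N)
  (X : set R[i]) (hX : compact X)
  (beta : 'I_n -> R) (hbeta : forall j, 0 < beta j < 1)
  (hsum : \sum_(j < n) beta j = 1)
  (r : 'I_n -> R) (hr : forall j, r j = beta j `^ (- ((p j + q j)%:R)^-1))
  (h1 : X 1)
  (hroots : \bigcup_(j in [set: 'I_n])
     [set (r j)%:C%C * z | z in roots_of_unity (d j)] `<=` X) :
  let G := monomials X p q in
  let M := lspan ([set 1] `|` G) in
  [/\ Cstar M = [set: cfun R X],
      (X `\` set_val @` choquet_boundary M) 1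
    & ~ hyperrigid G].
Proof.
move=> G M.
have cX := compact_set_type hX.
pose g j : cfun R X := cfun_conj (xi X) ^+ p j * xi X ^+ q j.
have gE j (x : X) : g j x = monomial (p j) (q j) (set_val x).
  by rewrite /g cfunM !cfunX.
have Gg j : G (g j) by exists j.
have beta0 j : 0 < beta j by case/andP: (hbeta j).
have pq0 j : (0 < p j + q j)%N.
  have := hd0 j; rewrite hd !lt0n; apply: contraNneq => /eqP.
  by rewrite addn_eq0 => /andP[/eqP-> /eqP->].
have rE j : r j ^+ (p j + q j) = (beta j)^-1.
  rewrite hr -powR_mulrn ?powR_ge0// -powRrM mulNr mulVf ?pnatr_eq0 -?lt0n//.
  by rewrite powR_inv1// ltW.
have [z zP] := boolp.choice (fun j => prim_root_exists R[i] (hd0 j)).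
(* One index for each point [r_j z_j^k] with [k < d_j]; the [d_j] points of circle [j] share the
   mass [beta_j] equally through the weights [c]. *)
pose I : finType := {j : 'I_n & 'I_(d j)}.
have [P PE] : {P : I -> X & forall i,
    set_val (P i) = (r (tag i))%:C%C * z (tag i) ^+ tagged i}.
  apply: (@boolp.choice _ _ (fun i x => set_val x = _)) => i.
  suff Xi : X ((r (tag i))%:C%C * z (tag i) ^+ tagged i).
    by exists (SigSub (mem_set Xi)).
  apply: hroots; exists (tag i) => //; exists (z (tag i) ^+ tagged i) => //.
  by rewrite /roots_of_unity/= exprAC (prim_expr_order (zP _)) expr1n.
pose c (i : I) : R := beta (tag i) / (d (tag i))%:R.
pose x1 : X := SigSub (mem_set h1).
have d0 j : (d j)%:R != 0 :> R by rewrite pnatr_eq0 -lt0n.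
have c_ge0 i : 0 <= c i by rewrite divr_ge0// ltW.
have c_sum : \sum_i c i = 1.
  rewrite -hsum (sum_tagged (fun j (k : 'I_(d j)) => beta j / (d j)%:R))/=.
  apply: eq_bigr => j _.
  by rewrite sumr_const card_ord -[LHS]mulr_natr divfK.
have g_x1 j : g j x1 = 1 by rewrite gE /monomial /= conjC1 !expr1n mulr1.
have averageG f : G f -> average P c f = f x1.
  move=> [j _ <-]; rewrite -/(g j) g_x1 /average.
  under eq_bigr => i _ do rewrite gE PE.
  rewrite (sum_tagged (fun i (k : 'I_(d i)) => (beta i / (d i)%:R)%:C%C *
    monomial (p j) (q j) ((r i)%:C%C * z i ^+ k)))/=.
  (* Circle [i] contributes only if [d i] divides [d j], which [hdvd] restricts to [i = j]; there
     the factors [beta j] and [r j ^+ (p j + q j)] cancel. *)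
  under eq_bigr => i _ do
    rewrite -mulr_sumr (sum_monomial_circle _ _ _ (zP i)) -hd.
  rewrite (bigD1 j)//= dvdnn big1 ?addr0 => [|i ij]; last first.
    by rewrite (negPf (hdvd _ _ ij)) mulr0.
  rewrite rE -(rmorph_nat (real_complex R) (d j)) -!rmorphM/=.
  by rewrite mulrA divfK// divff ?gt_eqF.
(* Any index [j0] would do. The point of index [i0] is [r_{j0}] itself ([k = 0]), where the
   generator takes the value [1 / beta_{j0} > 1]. *)
pose j0 := Ordinal (ltnW hn).
pose i0 : I := Tagged (fun j => 'I_(d j)) (Ordinal (hd0 j0)).
have g_i0 : g j0 (P i0) != g j0 x1.
  rewrite g_x1 gE PE /= expr0 mulr1 monomial_real rE.
  have /andP[b0 b1] := hbeta j0; rewrite -(rmorph1 (real_complex R)).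
  rewrite (inj_eq (@complexI R)) gt_eqF// invf_gt1//.
have c_i0 : 0 < c i0 < 1.
  have /andP[b0 b1] := hbeta j0.
  rewrite divr_gt0 ?ltr0n//= ltr_pdivrMr ?ltr0n// mul1r.
  by apply: lt_le_trans b1 _; rewrite ler1n.
split.
- apply: (stone_weierstrass x1 cX (@Cstar_subalgebra _ _ M) (@Cstar1 _ _ M))
    => x y xy.
  apply: val_inj; apply: (monomials_separate hd0 hgcd hd) => [|j].
    by exists j0.
  rewrite -!gE; apply: xy; apply: Cstar_gen.
  exists 1%N, (fun=> 1), (fun=> g j); split=> [_|]; first by right.
  by rewrite big_ord1 scale1r.
- split=> // -[x xM x1E].
  apply: (not_choquet_boundary cX c_ge0 c_sum averageG (Gg j0) g_i0 c_i0).
  by rewrite (_ : x1 = x)//; apply: val_inj.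
- exact: (not_hyperrigid cX c_ge0 c_sum averageG g_i0 c_i0).
Qed.
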